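(* Let $\mathcal{C}$ be a tensor category over an algebraically closed field $\mathbf{k}$. Consider $X\in\mathcal{C}$ with $X^{\ast\ast}\simeq X$ and $N\in\mathbb{Z}_{>0}$. (1) $X$ is strictly $N$-bounded if and only if $\mathbf{D}(X)=2\cos\left(\frac{\pi}{N}\right)$. (2) $X$ is unbounded if and only if $\mathbf{D}(X)\ge2$.
   Context: **Tensor category over $\mathbf{k}$:** an essentially small $\mathbf{k}$-linear monoidal category, abelian with all objects of finite length, every object having a left and a right dual, with $\mathbf{k}\to\mathrm{End}(\mathbf{1})$ an isomorphism. **Growth dimension.** Let $\ell(Y)$ be the length of $Y$. Set $\mathrm{gd}(Y)=\lim_{i\to\infty}\ell(Y^{\otimes i})^{1/i}\in\mathbb{R}\cup\{\infty\}$ (the limit is well-defined), and $\mathbf{D}(X)=\sqrt{\mathrm{gd}(X^\ast\otimes X)}\in\mathbb{R}\cup\{\infty\}$. A left dual of $X$ is $(X^\ast,\mathrm{ev}_X:X^\ast\otimes X\to\mathbf{1},\mathrm{co}_X:\mathbf{1}\to X\otimes X^\ast)$; ${}^\ast X$ is a right dual; $X^{(i)}$ is the $i$-th iterated left dual ($i\ge0$) or $(-i)$-th iterated right dual ($i<0$). $\mathcal{D}(\mathcal{C})$ is the derived category. Homological conventions: $C[1]_i=C_{i-1}$, $\mathrm{Cone}(f:C\to D)_i=C_{i-1}\oplus D_i$. **Continuant complexes.** $\mathbb{E}_0(X)=\mathbf{1}[0]$, $\mathbb{E}_1(X)=X[0]$, $f_1=\mathrm{ev}_X:X^\ast\otimes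 \mathbb{E}_1(X)\to\mathbb{E}_0(X)$. For $n\ge2$ iteratively, $\mathbb{E}_n(X)=\mathrm{Cone}(f_{n-1})[-1]$, with canonical chain map $\phi_n:\mathbb{E}_n(X)\to X^{(n-1)}\otimes\mathbb{E}_{n-1}(X)$, and $f_n:X^{(n)}\otimes\mathbb{E}_n(X)\to\mathbb{E}_{n-1}(X)$ is obtained from $\phi_n$ by adjunction, $f_n=(\mathrm{ev}_{X^{(n-1)}}\otimes \mathbb{E}_{n-1}(X))\circ(X^{(n)}\otimes\phi_n)$. Set $\mathbb{E}^n(X)=\mathbb{E}_n({}^\ast X)^\ast$ (termwise dual complex). **Boundedness.** $X$ is $N$-bounded if $\mathbb{E}_{N-1}(X)\simeq0\simeq\mathbb{E}^{N-1}(X)$ in $\mathcal{D}(\mathcal{C})$; strictly $N$-bounded if moreover it is not $N'$-bounded for any $1\le N'<N$; unbounded if it is not $N$-bounded for any $N\in\mathbb{Z}_{>0}$. *)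

(* Defs.v *)
From HB Require Import structures.
From mathcomp Require Import all_boot all_order all_algebra.
From mathcomp Require Import all_classical all_reals all_analysis.
Set Implicit Arguments.
Unset Strict Implicit.
Unset Printing Implicit Defensive.
Import Order.TTheory GRing.Theory Num.Theory.
Local Open Scope ring_scope.

Reserved Notation "g \oc f" (at level 39, left associativity).
Reserved Notation "f \ot g" (at level 37, left associativity).
Reserved Notation "A \oX B" (at level 37, left associativity).

(* The objects form a type (in some universe), so the categories are small;
   being essentially small is the equivalence-invariant form of this. *)
Record linCat (k : fieldType) := LinCat {
  ob :> Type;
  hom : ob -> ob -> lmodType k;
  idm : forall A, hom A A;
  comp : forall A B D, hom B D -> hom A B -> hom A D;
  comp1m : forall A B (f : hom A B), comp (idm B) f = f;
  compm1 : forall A B (f : hom A B), comp f (idm A) = f;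
  compA : forall A B D E (h : hom D E) (g : hom B D) (f : hom A B),
    comp h (comp g f) = comp (comp h g) f;
  comp_linl : forall A B D (a : k) (g g' : hom B D) (f : hom A B),
    comp (a *: g + g') f = a *: comp g f + comp g' f;
  comp_linr : forall A B D (a : k) (g : hom B D) (f f' : hom A B),
    comp g (a *: f + f') = a *: comp g f + comp g f' }.

Arguments idm {k l} A.
Notation "g \oc f" := (comp g f).

Section LinearCategories.
Context (k : fieldType) (C : linCat k).
Implicit Types A B D T : C.

Definition is_mono A B (f : hom A B) :=
  forall T (u v : hom T A), f \oc u = f \oc v -> u = v.

Definition is_epi A B (f : hom A B) :=
  forall T (u v : hom B T), u \oc f = v \oc f -> u = v.

Definition is_iso A B (f : hom A B) :=
  exists g : hom B A, g \oc f = idm A /\ f \oc g = idm B.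

Definition isomorphic A B := exists f : hom A B, is_iso f.

Definition is_zero A :=
  forall B, (forall f : hom A B, f = 0) /\ (forall f : hom B A, f = 0).

Definition is_kernel A B K (f : hom A B) (m : hom K A) :=
  f \oc m = 0 /\
  forall T (g : hom T A), f \oc g = 0 -> exists! u : hom T K, m \oc u = g.

Definition is_cokernel A B Q (f : hom A B) (e : hom B Q) :=
  e \oc f = 0 /\
  forall T (g : hom B T), g \oc f = 0 -> exists! u : hom Q T, u \oc e = g.

Lemma compDl A B D (g g' : hom B D) (f : hom A B) :
  (g + g') \oc f = g \oc f + g' \oc f.
Proof. by have := comp_linl 1 g g' f; rewrite !scale1r. Qed.

Lemma compDr A B D (g : hom B D) (f f' : hom A B) :
  g \oc (f + f') = g \oc f + g \oc f'.
Proof. by have := comp_linr 1 g f f'; rewrite !scale1r. Qed.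

Lemma comp0m A B D (f : hom A B) : (0 : hom B D) \oc f = 0.
Proof. by apply: (addrI ((0 : hom B D) \oc f)); rewrite -compDl !addr0. Qed.

Lemma compm0 A B D (g : hom B D) : g \oc (0 : hom A B) = 0.
Proof. by apply: (addrI (g \oc (0 : hom A B))); rewrite -compDr !addr0. Qed.

Lemma compZl A B D (a : k) (g : hom B D) (f : hom A B) :
  (a *: g) \oc f = a *: (g \oc f).
Proof. by have := comp_linl a g 0 f; rewrite !addr0 comp0m addr0. Qed.

Lemma compZr A B D (a : k) (g : hom B D) (f : hom A B) :
  g \oc (a *: f) = a *: (g \oc f).
Proof. by have := comp_linr a g f 0; rewrite !addr0 compm0 addr0. Qed.

Lemma compNl A B D (g : hom B D) (f : hom A B) : (- g) \oc f = - (g \oc f).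
Proof. by rewrite -scaleN1r compZl scaleN1r. Qed.

Lemma compNr A B D (g : hom B D) (f : hom A B) : g \oc (- f) = - (g \oc f).
Proof. by rewrite -scaleN1r compZr scaleN1r. Qed.

Lemma kernel_mono A B K (f : hom A B) (m : hom K A) :
  is_kernel f m -> is_mono m.
Proof.
move=> [fm0 H] T u v e.
have [|w [_ w_uniq]] := H T (m \oc u); first by rewrite compA fm0 comp0m.
by rewrite -(w_uniq u erefl) -(w_uniq v (esym e)).
Qed.

End LinearCategories.

(* All limits and colimits below are given by a choice of universal objects. *)
Record abCat (k : fieldType) := AbCat {
  ab_lin :> linCat k;
  zob : ab_lin;
  zobP : is_zero zob;
  bip : ab_lin -> ab_lin -> ab_lin;
  in1 : forall A B, hom A (bip A B);
  in2 : forall A B, hom B (bip A B);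
  pr1 : forall A B, hom (bip A B) A;
  pr2 : forall A B, hom (bip A B) B;
  pr1in1 : forall A B, pr1 A B \oc in1 A B = idm A;
  pr2in2 : forall A B, pr2 A B \oc in2 A B = idm B;
  pr1in2 : forall A B, pr1 A B \oc in2 A B = 0;
  pr2in1 : forall A B, pr2 A B \oc in1 A B = 0;
  bip_id : forall A B,
    in1 A B \oc pr1 A B + in2 A B \oc pr2 A B = idm (bip A B);
  ker : forall A B : ab_lin, hom A B -> ab_lin;
  kerm : forall A B (f : hom A B), hom (ker f) A;
  kerP : forall A B (f : hom A B), is_kernel f (kerm f);
  cok : forall A B : ab_lin, hom A B -> ab_lin;
  cokm : forall A B (f : hom A B), hom B (cok f);
  cokP : forall A B (f : hom A B), is_cokernel f (cokm f);
  mono_normal : forall (A B : ab_lin) (m : hom A B), is_mono m ->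
    exists (D : ab_lin) (g : hom B D), is_kernel g m;
  epi_conormal : forall (A B : ab_lin) (e : hom A B), is_epi e ->
    exists (D : ab_lin) (g : hom D A), is_cokernel g e }.

Arguments zob {k a}.

Section AbelianCategories.
Context (k : fieldType) (C : abCat k).
Implicit Types A B T Y S : C.

Definition is_simple S :=
  ~ is_zero S /\
  forall A (m : hom A S), is_mono m -> is_zero A \/ is_iso m.

Definition short_exact A B D (m : hom A B) (e : hom B D) :=
  is_kernel e m /\ is_cokernel m e.

(* [has_length Y n]: there is a composition series of [Y] with [n] simple
   subquotients. *)
Inductive has_length : C -> nat -> Prop :=
| Length0 Y : is_zero Y -> has_length Y 0
| LengthS Y' Y S n (m : hom Y' Y) (e : hom Y S) :
    short_exact m e -> is_simple S -> has_length Y' n -> has_length Y n.+1.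

Definition klift A B (f : hom A B) T (g : hom T A) (fg0 : f \oc g = 0) :
  hom T (ker f) := projT1 (cid ((kerP f).2 T g fg0)).

Lemma kliftE A B (f : hom A B) T (g : hom T A) (fg0 : f \oc g = 0) :
  kerm f \oc klift fg0 = g.
Proof. by rewrite /klift; case: cid => u []. Qed.

Definition cdesc A B (f : hom A B) T (g : hom B T) (gf0 : g \oc f = 0) :
  hom (cok f) T := projT1 (cid ((cokP f).2 T g gf0)).

Lemma cdescE A B (f : hom A B) T (g : hom B T) (gf0 : g \oc f = 0) :
  cdesc gf0 \oc cokm f = g.
Proof. by rewrite /cdesc; case: cid => u []. Qed.

End AbelianCategories.

(* Chain complexes indexed by all integers, in homological convention.  The
   differential is a family [cd i j] which vanishes unless [i = j + 1]; this
   avoids any transport along equalities of degrees. *)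
Record cpx (k : fieldType) (C : abCat k) := Cpx {
  cob :> int -> C;
  cd : forall i j, hom (cob i) (cob j);
  cd_shape : forall i j, i != j + 1 -> cd i j = 0;
  cdd : forall i j l, cd j l \oc cd i j = 0 }.

Record chmap (k : fieldType) (C : abCat k) (K L : cpx C) := ChMap {
  chf :> forall i, hom (K i) (L i);
  chf_comm : forall i j, chf j \oc cd K i j = cd L i j \oc chf i }.

Section Complexes.
Context (k : fieldType) (C : abCat k).
Implicit Types (K L M : cpx C).

Lemma chid_comm K i j : idm (K j) \oc cd K i j = cd K i j \oc idm (K i).
Proof. by rewrite comp1m compm1. Qed.

Definition chid K : chmap K K := ChMap (@chid_comm K).

Lemma chcomp_comm K L M (g : chmap L M) (f : chmap K L) i j :
  (g j \oc f j) \oc cd K i j = cd M i j \oc (g i \oc f i).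
Proof. by rewrite -compA chf_comm compA chf_comm -compA. Qed.

Definition chcomp K L M (g : chmap L M) (f : chmap K L) : chmap K M :=
  ChMap (chcomp_comm g f).

Definition cycles K (n : int) : C := ker (cd K n (n - 1)).

Definition bnd K n : hom (K (n + 1)) (cycles K n) :=
  klift (cdd K (n + 1) n (n - 1)).

Definition homology K n : C := cok (bnd K n).

Lemma cycles_map_subproof K L (f : chmap K L) n :
  cd L n (n - 1) \oc (f n \oc kerm (cd K n (n - 1))) = 0.
Proof. by rewrite compA -chf_comm -compA (kerP _).1 compm0. Qed.

Definition cycles_map K L (f : chmap K L) n : hom (cycles K n) (cycles L n) :=
  klift (cycles_map_subproof f n).

Lemma homology_map_subproof K L (f : chmap K L) n :
  (cokm (bnd L n) \oc cycles_map f n) \oc bnd K n = 0.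
Proof.
have e : cycles_map f n \oc bnd K n = bnd L n \oc f (n + 1).
  apply: (kernel_mono (kerP _)); rewrite compA kliftE -compA kliftE.
  by rewrite compA kliftE chf_comm.
by rewrite -compA e compA (cokP _).1 comp0m.
Qed.

Definition homology_map K L (f : chmap K L) n :
  hom (homology K n) (homology L n) := cdesc (homology_map_subproof f n).

Definition quasi_iso K L (f : chmap K L) := forall n, is_iso (homology_map f n).

(* The derived category is the localization of the category of complexes at
   the quasi-isomorphisms: its morphisms are the formal composites of chain
   maps and formal inverses of quasi-isomorphisms, modulo [deq]. *)
Inductive dhom : cpx C -> cpx C -> Type :=
| DId K : dhom K K
| DMap K L : chmap K L -> dhom K L
| DInv K L (s : chmap K L) : quasi_iso s -> dhom L K
| DComp K L M : dhom L M -> dhom K L -> dhom K M.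

Inductive deq : forall K L : cpx C, dhom K L -> dhom K L -> Prop :=
| deq_refl K L (u : dhom K L) : deq u u
| deq_sym K L (u v : dhom K L) : deq u v -> deq v u
| deq_trans K L (u v w : dhom K L) : deq u v -> deq v w -> deq u w
| deq_congr K L M (v v' : dhom L M) (u u' : dhom K L) :
    deq v v' -> deq u u' -> deq (DComp v u) (DComp v' u')
| deq_idl K L (u : dhom K L) : deq (DComp (DId L) u) u
| deq_idr K L (u : dhom K L) : deq (DComp u (DId K)) u
| deq_assoc K L M P (w : dhom M P) (v : dhom L M) (u : dhom K L) :
    deq (DComp w (DComp v u)) (DComp (DComp w v) u)
| deq_map_id K : deq (DMap (chid K)) (DId K)
| deq_map_comp K L M (g : chmap L M) (f : chmap K L) :
    deq (DMap (chcomp g f)) (DComp (DMap g) (DMap f))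
| deq_invl K L (s : chmap K L) (hs : quasi_iso s) :
    deq (DComp (DInv hs) (DMap s)) (DId K)
| deq_invr K L (s : chmap K L) (hs : quasi_iso s) :
    deq (DComp (DMap s) (DInv hs)) (DId L).

Definition derived_iso K L := exists (u : dhom K L) (v : dhom L K),
  deq (DComp v u) (DId K) /\ deq (DComp u v) (DId L).

Definition conc_ob (A : C) (i : int) : C := if i == 0 then A else zob.

Lemma conc_dd (A : C) (i j l : int) :
  (0 : hom (conc_ob A j) (conc_ob A l)) \oc (0 : hom (conc_ob A i) _) = 0.
Proof. exact: comp0m. Qed.

Definition conc (A : C) : cpx C :=
  @Cpx k C (conc_ob A) (fun _ _ => 0) (fun _ _ _ => erefl) (@conc_dd A).

(* The identity of [K i] if [i = j], and zero otherwise. *)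
Definition idx K (i j : int) : hom (K i) (K j) :=
  match i =P j with
  | ReflectT e => ecast j (hom (K i) (K j)) e (idm (K i))
  | ReflectF _ => 0
  end.

Lemma idx_refl K i : idx K i i = idm (K i).
Proof. by rewrite /idx; case: eqP => // e; rewrite (eq_axiomK e). Qed.

Lemma idx_neq K i j : i != j -> idx K i j = 0.
Proof. by rewrite /idx; case: eqP. Qed.

Lemma idx_cd K i i' j j' : i = i' -> j = j' ->
  idx K j j' \oc cd K i j = cd K i' j' \oc idx K i i'.
Proof. by move=> <- <-; rewrite !idx_refl comp1m compm1. Qed.

Lemma idx_cd_shape K i i' j j' : i' = j + 1 ->
  idx K j j' \oc cd K i j = cd K i' j' \oc idx K i i'.
Proof.
move=> ei'; have [ei|ni] := eqVneq i i'; last first.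
  by rewrite (idx_neq _ ni) compm0 cd_shape ?compm0 // -ei'.
have [ej|nj] := eqVneq j j'; first exact: idx_cd.
rewrite (idx_neq _ nj) comp0m (@cd_shape _ _ K i') ?comp0m //.
by rewrite ei' (inj_eq (addIr _)).
Qed.

Lemma chf_idx K L (f : chmap K L) i j : f j \oc idx K i j = idx L i j \oc f i.
Proof.
have [<-|n] := eqVneq i j; first by rewrite !idx_refl comp1m compm1.
by rewrite !idx_neq // comp0m compm0.
Qed.

Definition shift_cd (p : int) K i j : hom (K (i - p)) (K (j - p)) :=
  (-1) ^+ `|p|%N *: cd K (i - p) (j - p).

Lemma shift_shape p K i j : i != j + 1 -> shift_cd p K i j = 0.
Proof.
move=> n; rewrite /shift_cd cd_shape ?scaler0 //.
by rewrite addrAC (inj_eq (addIr _)).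
Qed.

Lemma shift_dd p K i j l : shift_cd p K j l \oc shift_cd p K i j = 0.
Proof. by rewrite compZl compZr cdd !scaler0. Qed.

(* [cshift p K] is K[p], with K[p]_i = K_(i-p). *)
Definition cshift (p : int) K : cpx C :=
  @Cpx k C (fun i => K (i - p)) (shift_cd p K)
    (@shift_shape p K) (@shift_dd p K).

Section Cone.
Context (K L : cpx C) (f : chmap K L).

Definition cone_ob (i : int) : C := bip (K (i - 1)) (L i).

(* The differential (x, y) |-> (- d x, f x + d y). *)
Definition cone_cd i j : hom (cone_ob i) (cone_ob j) :=
  in1 _ _ \oc (- cd K (i - 1) (j - 1)) \oc pr1 _ _ +
  in2 _ _ \oc (idx L (i - 1) j \oc f (i - 1)) \oc pr1 _ _ +
  in2 _ _ \oc cd L i j \oc pr2 _ _.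

Lemma cone_shape i j : i != j + 1 -> cone_cd i j = 0.
Proof.
move=> n; rewrite /cone_cd (@cd_shape _ _ L) // (@cd_shape _ _ K); last first.
  by rewrite subrK subr_eq.
rewrite idx_neq ?subr_eq //.
by rewrite oppr0 !(compm0, comp0m) !addr0.
Qed.

Lemma pr1_cone i j :
  pr1 _ _ \oc cone_cd i j = - cd K (i - 1) (j - 1) \oc pr1 _ _.
Proof.
by rewrite /cone_cd !compDr !compA pr1in1 pr1in2 !comp0m !addr0 comp1m.
Qed.

Lemma pr2_cone i j : pr2 _ _ \oc cone_cd i j =
  (idx L (i - 1) j \oc f (i - 1)) \oc pr1 _ _ + cd L i j \oc pr2 _ _.
Proof.
by rewrite /cone_cd !compDr !compA pr2in1 pr2in2 !comp0m add0r !comp1m.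
Qed.

Lemma cone_dd i j l : cone_cd j l \oc cone_cd i j = 0.
Proof.
rewrite {1}/cone_cd !compDl -!compA pr1_cone pr2_cone !compDr !compA.
rewrite !(compNl, compNr, compA).
rewrite -(compA _ (cd K _ _) (cd K _ _)) cdd compm0 !comp0m !oppr0 add0r.
rewrite -(compA _ (cd L _ _) (cd L _ _)) cdd compm0 !comp0m addr0.
have [ej|nj] := eqVneq i (j + 1); last first.
  rewrite (@cd_shape _ _ K (i - 1)) ?subrK ?subr_eq //.
  rewrite (@idx_neq L (i - 1)) ?subr_eq //.
  by rewrite !(compm0, comp0m) oppr0 addr0.
rewrite -!compA (compA (f _)) chf_comm !compA.
rewrite -(compA (in2 _ _) (idx L _ _)) (@idx_cd_shape L _ j) ?subrK //.
by rewrite !compA addNr.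
Qed.

Definition cone : cpx C := @Cpx k C cone_ob cone_cd cone_shape cone_dd.

Definition cofib_map i : hom (cshift (-1) cone i) (K i) :=
  idx K (i - -1 - 1) i \oc pr1 _ _.

Lemma cofib_map_comm i j :
  cofib_map j \oc cd (cshift (-1) cone) i j = cd K i j \oc cofib_map i.
Proof.
rewrite /cofib_map /= /shift_cd /= expr1 scaleN1r compNr -compA pr1_cone.
rewrite compA compNr compNl [LHS]opprK.
have e m : m - -1 - 1 = m :> int by rewrite opprK addrK.
by rewrite (idx_cd _ (e i) (e j)) compA.
Qed.

(* The canonical map Cone(f)[-1] -> K. *)
Definition cofib : chmap (cshift (-1) cone) K := ChMap cofib_map_comm.

End Cone.

End Complexes.

(* An abelian category with a k-linear (not necessarily strict) monoidal
   structure. *)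
Record monAbCat (k : fieldType) := MonAbCat {
  mon_ab :> abCat k;
  unit_ob : mon_ab;
  tens : mon_ab -> mon_ab -> mon_ab;
  tensm : forall A A' B B' : mon_ab,
    hom A A' -> hom B B' -> hom (tens A B) (tens A' B');
  tensm1 : forall A B, tensm (idm A) (idm B) = idm (tens A B);
  tensm_comp : forall (A A' A'' B B' B'' : mon_ab) (f' : hom A' A'')
    (f : hom A A') (g' : hom B' B'') (g : hom B B'),
    tensm (f' \oc f) (g' \oc g) = tensm f' g' \oc tensm f g;
  tensm_linl : forall (A A' B B' : mon_ab) (a : k) (f f' : hom A A')
    (g : hom B B'), tensm (a *: f + f') g = a *: tensm f g + tensm f' g;
  tensm_linr : forall (A A' B B' : mon_ab) (a : k) (f : hom A A')
    (g g' : hom B B'), tensm f (a *: g + g') = a *: tensm f g + tensm f g';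
  asc : forall A B D, hom (tens (tens A B) D) (tens A (tens B D));
  ascV : forall A B D, hom (tens A (tens B D)) (tens (tens A B) D);
  ascK : forall A B D, ascV A B D \oc asc A B D = idm _;
  ascVK : forall A B D, asc A B D \oc ascV A B D = idm _;
  asc_nat : forall (A A' B B' D D' : mon_ab) (f : hom A A') (g : hom B B')
    (h : hom D D'), asc A' B' D' \oc tensm (tensm f g) h =
                    tensm f (tensm g h) \oc asc A B D;
  lun : forall A, hom (tens unit_ob A) A;
  lunV : forall A, hom A (tens unit_ob A);
  lunK : forall A, lunV A \oc lun A = idm _;
  lunVK : forall A, lun A \oc lunV A = idm _;
  lun_nat : forall (A A' : mon_ab) (f : hom A A'),
    lun A' \oc tensm (idm unit_ob) f = f \oc lun A;
  run : forall A, hom (tens A unit_ob) A;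
  runV : forall A, hom A (tens A unit_ob);
  runK : forall A, runV A \oc run A = idm _;
  runVK : forall A, run A \oc runV A = idm _;
  run_nat : forall (A A' : mon_ab) (f : hom A A'),
    run A' \oc tensm f (idm unit_ob) = f \oc run A;
  pentagon : forall A B D E,
    asc A B (tens D E) \oc asc (tens A B) D E =
    tensm (idm A) (asc B D E) \oc asc A (tens B D) E \oc
      tensm (asc A B D) (idm E);
  triangle : forall A B,
    tensm (idm A) (lun B) \oc asc A unit_ob B = tensm (run A) (idm B) }.

Arguments unit_ob {k m}.
Notation "A \oX B" := (tens A B).
Notation "f \ot g" := (tensm f g).

(* [Y] is a left dual of [X], with evaluation [ev] and coevaluation [co];
   equivalently [X] is a right dual of [Y]. *)
Definition is_left_dual (k : fieldType) (C : monAbCat k) (X Y : C)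
    (ev : hom (Y \oX X) unit_ob) (co : hom unit_ob (X \oX Y)) :=
  run X \oc (idm X \ot ev) \oc asc X Y X \oc (co \ot idm X) = lun X /\
  lun Y \oc (ev \ot idm Y) \oc ascV Y X Y \oc (idm Y \ot co) = run Y.

Record tensorCat (k : fieldType) := TensorCat {
  tc_mon :> monAbCat k;
  flen : forall Y : tc_mon, exists n, has_length Y n;
  ldual : tc_mon -> tc_mon;
  ev : forall X, hom (ldual X \oX X) unit_ob;
  co : forall X, hom unit_ob (X \oX ldual X);
  ldualP : forall X, is_left_dual (ev X) (co X);
  rdual : tc_mon -> tc_mon;
  revl : forall X, hom (X \oX rdual X) unit_ob;
  rcol : forall X, hom unit_ob (rdual X \oX X);
  rdualP : forall X, is_left_dual (revl X) (rcol X);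
  end_one : bijective (fun a : k => a *: idm (unit_ob : tc_mon)) }.

Section TensorFunctor.
Context (k : fieldType) (C : monAbCat k).
Implicit Types A B D X Y : C.

Lemma tensm0l A A' B B' (g : hom B B') : (0 : hom A A') \ot g = 0.
Proof.
have := tensm_linl (-1) (0 : hom A A') 0 g.
by rewrite scaler0 addr0 scaleN1r addNr.
Qed.

Lemma tensm0r A A' B B' (f : hom A A') : f \ot (0 : hom B B') = 0.
Proof.
have := tensm_linr (-1) f (0 : hom B B') 0.
by rewrite scaler0 addr0 scaleN1r addNr.
Qed.

Lemma tensm_compl A A' A'' B (g : hom A' A'') (f : hom A A') :
  (g \oc f) \ot idm B = (g \ot idm B) \oc (f \ot idm B).
Proof. by rewrite -tensm_comp comp1m. Qed.

Lemma tensm_compr A B B' B'' (g : hom B' B'') (f : hom B B') :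
  idm A \ot (g \oc f) = (idm A \ot g) \oc (idm A \ot f).
Proof. by rewrite -tensm_comp comp1m. Qed.

Lemma tens_shape Y (K : cpx C) i j : i != j + 1 -> idm Y \ot cd K i j = 0.
Proof. by move=> n; rewrite cd_shape // tensm0r. Qed.

Lemma tens_dd Y (K : cpx C) i j l :
  (idm Y \ot cd K j l) \oc (idm Y \ot cd K i j) = 0.
Proof. by rewrite -tensm_comp cdd tensm0r. Qed.

Definition tens_cpx Y (K : cpx C) : cpx C :=
  @Cpx k C (fun i => Y \oX K i) (fun i j => idm Y \ot cd K i j)
    (@tens_shape Y K) (@tens_dd Y K).

Section Kelly.

Lemma lun_faithful A B (f g : hom A B) :
  idm unit_ob \ot f = idm unit_ob \ot g -> f = g.
Proof.
move=> e; rewrite -(compm1 f) -(compm1 g) -!lunVK !compA -!lun_nat.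
by rewrite e.
Qed.

Lemma run_faithful A B (f g : hom A B) :
  f \ot idm unit_ob = g \ot idm unit_ob -> f = g.
Proof.
move=> e; rewrite -(compm1 f) -(compm1 g) -!runVK !compA -!run_nat.
by rewrite e.
Qed.

Lemma asc_epi A B D E (u v : hom (A \oX (B \oX D)) E) :
  u \oc asc A B D = v \oc asc A B D -> u = v.
Proof. by move=> e; rewrite -(compm1 u) -(compm1 v) -ascVK !compA e. Qed.

Lemma asc_mono A B D E (u v : hom E ((A \oX B) \oX D)) :
  asc A B D \oc u = asc A B D \oc v -> u = v.
Proof. by move=> e; rewrite -(comp1m u) -(comp1m v) -ascK -!compA e. Qed.

Lemma tens_asc_epi A B D F E
    (u v : hom ((A \oX (B \oX D)) \oX F) E) :
  u \oc (asc A B D \ot idm F) = v \oc (asc A B D \ot idm F) -> u = v.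
Proof.
move=> e; rewrite -(compm1 u) -(compm1 v) -tensm1 -ascVK -(comp1m (idm F)).
by rewrite tensm_comp !compA e.
Qed.

Lemma lun_tens A B : lun (A \oX B) \oc asc unit_ob A B = lun A \ot idm B.
Proof.
apply: lun_faithful; apply: asc_epi; apply: tens_asc_epi.
rewrite -asc_nat -[in RHS]compA -tensm_comp triangle comp1m.
rewrite tensm_compr.
rewrite -!compA (compA (idm unit_ob \ot asc _ _ _)) -pentagon.
by rewrite compA triangle -(tensm1 A B) -asc_nat.
Qed.

Lemma run_tens A B : (idm A \ot run B) \oc asc A B unit_ob = run (A \oX B).
Proof.
apply: run_faithful; apply: asc_mono.
rewrite tensm_compl compA asc_nat -!triangle tensm_compr.
rewrite -!compA (compA (idm A \ot asc _ _ _)) -pentagon -(tensm1 A B).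
by rewrite !compA asc_nat.
Qed.

Lemma lun_run : lun unit_ob = run (unit_ob : C).
Proof.
apply: run_faithful; rewrite -lun_tens -triangle; congr (_ \oc _).
have H : lun unit_ob \oc lun (unit_ob \oX unit_ob) =
  lun unit_ob \oc (idm unit_ob \ot lun unit_ob)
  :> hom _ (unit_ob : C) by rewrite lun_nat.
have : lunV unit_ob \oc (lun unit_ob \oc lun (unit_ob \oX unit_ob)) =
       lunV unit_ob \oc (lun unit_ob \oc (idm unit_ob \ot lun unit_ob))
       :> hom _ (_ : C).
  by rewrite H.
by rewrite !compA lunK !comp1m.
Qed.

End Kelly.

End TensorFunctor.

Section TensorCategories.
Context (k : fieldType) (C : tensorCat k).
Implicit Types A B D X Y : C.

(* The length does not depend on the chosen composition series
   (Jordan-Hoelder). *)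
Definition len Y : nat := projT1 (cid (flen Y)).

Fixpoint tpow Y (n : nat) : C := if n is m.+1 then tpow Y m \oX Y else unit_ob.

Definition ldualm A B (f : hom A B) : hom (ldual B) (ldual A) :=
  lun (ldual A) \oc ((ev B \oc (idm (ldual B) \ot f)) \ot idm (ldual A)) \oc
  ascV (ldual B) A (ldual A) \oc (idm (ldual B) \ot co A) \oc runV (ldual B).

Lemma ev_inj T A (u : hom T (ldual A)) :
  ev A \oc (u \ot idm A) = 0 -> u = 0.
Proof.
move=> e; suff: u \oc run T = 0.
  by move=> e'; rewrite -(compm1 u) -runVK compA e' comp0m.
rewrite -run_nat -(ldualP A).2 -compA -tensm_comp comp1m compm1.
have -> : u \ot co A = (u \ot idm _) \oc (idm T \ot co A).
  by rewrite -tensm_comp comp1m compm1.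
have N : ascV (ldual A) A (ldual A) \oc (u \ot idm _) =
    ((u \ot idm A) \ot idm (ldual A)) \oc ascV T A (ldual A).
  apply: asc_mono; rewrite !compA ascVK comp1m asc_nat -compA ascVK compm1.
  by rewrite tensm1.
rewrite compA -(compA _ (ascV _ _ _)) N !compA.
rewrite -(compA (lun _)) -tensm_comp e tensm0l.
by rewrite compm0 !comp0m.
Qed.

Lemma ldualmE A B (f : hom A B) :
  ev A \oc (ldualm f \ot idm A) = ev B \oc (idm _ \ot f).
Proof.
rewrite /ldualm; move: (ev B \oc _) => h; set T := ldual B in h *.
rewrite !tensm_compl -lun_tens !compA -lun_nat.
rewrite -(compA _ (asc _ _ _)) asc_nat !compA tensm1.
rewrite -(compA (lun unit_ob)) -tensm_comp comp1m compm1.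
have -> : h \ot ev A = (h \ot idm unit_ob) \oc (idm (T \oX A) \ot ev A).
  by rewrite -tensm_comp comp1m compm1.
rewrite !compA lun_run run_nat.
rewrite -run_tens -!compA.
suff -> : (idm T \ot run A) \oc
  (asc T A unit_ob \oc
   ((idm (T \oX A) \ot ev A) \oc
    (asc (T \oX A) (ldual A) A \oc
     ((ascV T A (ldual A) \ot idm A) \oc
      (((idm T \ot co A) \ot idm A) \oc (runV T \ot idm A)))))) = idm _.
  by rewrite compm1.
rewrite (compA (asc T A unit_ob)) -(tensm1 T A) asc_nat.
rewrite -(compA _ (asc T A _)) (compA (asc T A _)) pentagon.
rewrite -!compA (compA (asc T A _ \ot _)) -tensm_comp ascVK comp1m tensm1.
rewrite comp1m (compA (asc T _ A)) asc_nat -!compA.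
rewrite !compA -!tensm_compr (ldualP A).1 triangle -tensm_compl runVK.
by rewrite tensm1.
Qed.

Lemma ldualm0 A B : ldualm (0 : hom A B) = 0.
Proof. by apply: ev_inj; rewrite ldualmE tensm0r compm0. Qed.

Lemma ldualm_comp A B D (g : hom B D) (f : hom A B) :
  g \oc f = 0 -> ldualm f \oc ldualm g = 0.
Proof.
move=> gf0; apply: ev_inj.
rewrite tensm_compl compA ldualmE -compA -tensm_comp.
rewrite comp1m compm1 -[ldualm g]compm1 -[f]comp1m tensm_comp compA ldualmE.
by rewrite -!compA -tensm_compr gf0 tensm0r compm0.
Qed.

Section DualComplex.
Context (K : cpx C).

Definition dual_cd (i j : int) : hom (ldual (K (- i))) (ldual (K (- j))) :=
  ldualm (cd K (- j) (- i)).

Lemma dual_shape i j : i != j + 1 -> dual_cd i j = 0.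
Proof.
move=> n; rewrite /dual_cd cd_shape ?ldualm0 //.
by rewrite -subr_eq -opprD eqr_opp eq_sym.
Qed.

Lemma dual_dd i j l : dual_cd j l \oc dual_cd i j = 0.
Proof. exact/ldualm_comp/cdd. Qed.

Definition dual_cpx : cpx C :=
  @Cpx k C (fun i => ldual (K (- i))) dual_cd dual_shape dual_dd.

End DualComplex.

Definition itdual X (n : nat) : C := iter n (@ldual k C) X.

Section ConcentratedMap.
Context (Y A B : C) (f : hom (Y \oX A) B).

Definition conc_map (i : int) : hom (tens_cpx Y (conc A) i) (conc B i) :=
  if i == 0 as b
    return hom (Y \oX (if b then A else zob)) (if b then B else zob)
  then f else 0.

Lemma conc_map_comm i j : conc_map j \oc cd (tens_cpx Y (conc A)) i j =
  cd (conc B) i j \oc conc_map i.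
Proof. by rewrite /= tensm0r compm0 comp0m. Qed.

Definition conc_chmap : chmap (tens_cpx Y (conc A)) (conc B) :=
  ChMap conc_map_comm.

End ConcentratedMap.

Section Adjunct.
Context (Y : C) (K L : cpx C) (phi : chmap K (tens_cpx Y L)).

Definition adj_map (i : int) : hom (tens_cpx (ldual Y) K i) (L i) :=
  lun (L i) \oc (ev Y \ot idm (L i)) \oc ascV (ldual Y) Y (L i) \oc
  (idm (ldual Y) \ot phi i).

Lemma adj_map_comm i j :
  adj_map j \oc cd (tens_cpx (ldual Y) K) i j = cd L i j \oc adj_map i.
Proof.
rewrite /adj_map /= -!compA -tensm_compr (chf_comm phi i j) /=.
rewrite (compA (cd L i j)) -lun_nat -!compA.
rewrite tensm_compr.
rewrite (compA (ascV _ _ _)).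
have -> : ascV (ldual Y) Y (L j) \oc (idm (ldual Y) \ot (idm Y \ot cd L i j)) =
          (idm (ldual Y \oX Y) \ot cd L i j) \oc ascV _ _ _.
  apply: asc_mono; rewrite !compA ascVK comp1m -tensm1 asc_nat -compA.
  by rewrite ascVK compm1.
rewrite !compA -!(compA (lun _)) -!tensm_comp.
by rewrite !(comp1m, compm1).
Qed.

(* The map Y^* (x) K -> L adjoint to K -> Y (x) L. *)
Definition adj : chmap (tens_cpx (ldual Y) K) L := ChMap adj_map_comm.

End Adjunct.

(* For n >= 1, the triple of E_(n-1), E_n and f_n : X^(n) (x) E_n -> E_(n-1). *)
Record cstage X (n : nat) := CStage {
  st_prev : cpx C;
  st_cur : cpx C;
  st_map : chmap (tens_cpx (itdual X n) st_cur) st_prev }.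

Definition cnext X n (s : cstage X n) : cstage X n.+1 :=
  @CStage X n.+1 (st_cur s) (cshift (-1) (cone (st_map s)))
    (adj (cofib (st_map s))).

Fixpoint continuant X (n : nat) : cstage X n.+1 :=
  if n is m.+1 then cnext (continuant X m)
  else @CStage X 1 (conc unit_ob) (conc X) (conc_chmap (ev X)).

(* E_n(X) *)
Definition Elow X (n : nat) : cpx C :=
  if n is m.+1 then st_cur (continuant X m) else conc unit_ob.

(* E^n(X) *)
Definition Eup X (n : nat) : cpx C := dual_cpx (Elow (rdual X) n).

Definition zero_cpx : cpx C := conc zob.

(* Only meaningful for [0 < N]. *)
Definition bounded X (N : nat) :=
  derived_iso (Elow X N.-1) zero_cpx /\ derived_iso (Eup X N.-1) zero_cpx.

Definition strictly_bounded X (N : nat) :=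
  bounded X N /\ forall N', (1 <= N' < N)%N -> ~ bounded X N'.

Definition unbounded X := forall N, (0 < N)%N -> ~ bounded X N.

(* The term at i = 0 is irrelevant; for i > 0 this is the i-th root. *)
Definition growth_dim (R : realType) Y : \bar R :=
  limn (fun i => (((len (tpow Y i))%:R : R) `^ (i%:R^-1))%:E).

Definition bfD (R : realType) X : \bar R :=
  sqrte (growth_dim R (ldual X \oX X)).

End TensorCategories.

(* Main.v *)
Require Import Defs.
From mathcomp Require Import all_boot all_order all_algebra.
From mathcomp Require Import all_classical all_reals all_analysis.
From mathcomp Require Import ring.
Local Open Scope ring_scope.

(* Write M_n for the kernel of the differential of E_n in degree 0 and
   f_n : X^(n) (x) M_n -> M_(n-1) for the induced map.  By induction, as long as
   M_0, ..., M_n are nonzero, E_n is a resolution of M_n and the pair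
   (M_n, M_(n-1)) has only scalar endomorphisms, even after tensoring with an
   arbitrary object on the right.  A nonzero cokernel of f_n would give a nonzero
   endomorphism which vanishes on M_n; so f_n is epi, and its kernel is M_(n+1).

   Hence, when tensoring M_j alternately with X and X^*, lengths satisfy
   l(X^(j) (x) M_j) = l(M_(j+1)) + l(M_(j-1)): they count walks on the Dynkin
   diagram A_(N-1) if M_(N-1) is the first zero object.  The vector
   sin((j+1) pi/N) is positive with eigenvalue 2 cos(pi/N), which bounds the
   growth of l(... X^* (x) X) from both sides; if no M_j vanishes the lower bound
   holds for all N.  Comparing growth rates also shows that the first zero is at
   the same place for X and for its dual.  Since l(A (x) B) >= l(A) l(B), the
   growth dimension is a supremum (Fekete), so such bounds determine it. *)

Import Defs.
Set Implicit Arguments.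
Unset Strict Implicit.
Unset Printing Implicit Defensive.
Import Order.TTheory GRing.Theory Num.Theory.
Import numFieldNormedType.Exports.

(** * Abelian categories *)

Section LinearCategories.
Context (k : fieldType) (C : linCat k).
Implicit Types A B D T : C.

Lemma monoP A B (f : hom A B) :
  is_mono f <-> forall T (u : hom T A), f \oc u = 0 -> u = 0.
Proof.
split=> [fm T u fu|H T u v e]; first by apply: fm; rewrite fu compm0.
by apply/eqP; rewrite -subr_eq0; apply/eqP/H; rewrite compDr compNr e subrr.
Qed.

Lemma epiP A B (f : hom A B) :
  is_epi f <-> forall T (u : hom B T), u \oc f = 0 -> u = 0.
Proof.
split=> [fm T u fu|H T u v e]; first by apply: fm; rewrite fu comp0m.
by apply/eqP; rewrite -subr_eq0; apply/eqP/H; rewrite compDl compNl e subrr.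
Qed.

Lemma is_zeroP A : is_zero A <-> idm A = 0.
Proof.
split=> [A0|e B]; first exact: (A0 A).1.
split=> f.
  by rewrite -(compm1 f) e compm0.
by rewrite -(comp1m f) e comp0m.
Qed.

Lemma mono_comp A B D (g : hom B D) (f : hom A B) :
  is_mono g -> is_mono f -> is_mono (g \oc f).
Proof. by move=> gm fm T u v; rewrite -!compA => /gm/fm. Qed.

Lemma epi_comp A B D (g : hom B D) (f : hom A B) :
  is_epi g -> is_epi f -> is_epi (g \oc f).
Proof. by move=> gm fm T u v; rewrite !compA => /fm/gm. Qed.

Lemma epi_id A : is_epi (idm A).
Proof. by move=> T u v; rewrite !compm1. Qed.

Lemma iso_mono A B (f : hom A B) : is_iso f -> is_mono f.
Proof.
by move=> [g [gf _]] T u v e; rewrite -(comp1m u) -(comp1m v) -gf -!compA e.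
Qed.

Lemma iso_epi A B (f : hom A B) : is_iso f -> is_epi f.
Proof.
by move=> [g [_ fg]] T u v e; rewrite -(compm1 u) -(compm1 v) -fg !compA e.
Qed.

Lemma isomorphic_sym A B : isomorphic A B -> isomorphic B A.
Proof. by move=> [f [g [gf fg]]]; exists g, f. Qed.

Lemma isomorphic_refl A : isomorphic A A.
Proof. by exists (idm A), (idm A); rewrite comp1m. Qed.

Lemma isomorphic_trans A B D : isomorphic A B -> isomorphic B D -> isomorphic A D.
Proof.
move=> [f [g [gf fg]]] [f' [g' [gf' fg']]]; exists (f' \oc f), (g \oc g').
split; first by rewrite -compA (compA g') gf' comp1m gf.
by rewrite -compA (compA f) fg comp1m fg'.
Qed.

Lemma is_zero_mono A B (f : hom A B) : is_mono f -> is_zero B -> is_zero A.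
Proof.
move=> /monoP fm /is_zeroP B0; apply/is_zeroP/fm.
by rewrite compm1 -(comp1m f) B0 comp0m.
Qed.

Lemma is_zero_epi A B (f : hom A B) : is_epi f -> is_zero A -> is_zero B.
Proof.
move=> /epiP fm /is_zeroP A0; apply/is_zeroP/fm.
by rewrite comp1m -(compm1 f) A0 compm0.
Qed.

Lemma is_zero_iso A B : isomorphic A B -> is_zero A -> is_zero B.
Proof. by move=> [f fi]; apply: is_zero_epi (iso_epi fi). Qed.

Lemma mono_cancel A B D (g : hom B D) (f : hom A B) :
  is_mono (g \oc f) -> is_mono f.
Proof. by move=> gf T u v e; apply: gf; rewrite -!compA e. Qed.

Lemma epi_cancel A B D (g : hom B D) (f : hom A B) :
  is_epi (g \oc f) -> is_epi g.
Proof. by move=> gf T u v e; apply: gf; rewrite !compA e. Qed.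

Lemma kernelI A B K (f : hom A B) (m : hom K A) : is_mono m -> f \oc m = 0 ->
  (forall T (g : hom T A), f \oc g = 0 -> exists u, m \oc u = g) ->
  is_kernel f m.
Proof.
move=> mm fm0 H; split=> // T g fg0; have [u e] := H T g fg0; exists u.
by split=> // v e'; apply: mm; rewrite e e'.
Qed.

Lemma kernel_lift A B K (f : hom A B) (m : hom K A) T (g : hom T A) :
  is_kernel f m -> f \oc g = 0 -> exists u, m \oc u = g.
Proof. by move=> [_ H] /H [u []]; exists u. Qed.

Lemma cokernelI A B Q (f : hom A B) (e : hom B Q) : is_epi e -> e \oc f = 0 ->
  (forall T (g : hom B T), g \oc f = 0 -> exists u, u \oc e = g) ->
  is_cokernel f e.
Proof.
move=> mm fm0 H; split=> // T g fg0; have [u e1] := H T g fg0; exists u.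
by split=> // v e'; apply: mm; rewrite e1 e'.
Qed.

Lemma cokernel_desc A B Q (f : hom A B) (e : hom B Q) T (g : hom B T) :
  is_cokernel f e -> g \oc f = 0 -> exists u, u \oc e = g.
Proof. by move=> [_ H] /H [u []]; exists u. Qed.

Lemma cokernel_epi A B Q (f : hom A B) (e : hom B Q) :
  is_cokernel f e -> is_epi e.
Proof.
move=> [ef0 H] T u v E.
have [|w [_ w_uniq]] := H T (u \oc e); first by rewrite -compA ef0 compm0.
by rewrite -(w_uniq u erefl) -(w_uniq v (esym E)).
Qed.

End LinearCategories.

Section Abelian.
Context (k : fieldType) (C : abCat k).
Implicit Types A B D T S U Q Y : C.

Lemma simple_iso (S S' : C) : isomorphic S S' -> is_simple S -> is_simple S'.
Proof.
move=> [f [g [gf fg]]] [S0 H]; split.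
  by move=> S'0; apply: S0; apply: is_zero_iso S'0; exists g, f.
move=> A m mm; have gi : is_iso g by exists f.
have [A0|[h [h1 h2]]] := H A (g \oc m) (mono_comp (iso_mono gi) mm).
  by left.
right; exists (h \oc g); split; first by rewrite -compA.
have : f \oc ((g \oc m) \oc h) \oc g = idm S' by rewrite h2 compm1.
by rewrite !compA fg comp1m.
Qed.

Lemma kerm_mono A B (f : hom A B) : is_mono (kerm f).
Proof. exact: kernel_mono (kerP f). Qed.

Lemma cokm_epi A B (f : hom A B) : is_epi (cokm f).
Proof. exact: cokernel_epi (cokP f). Qed.

(** If m is a kernel of g, then g factors through [cokm m]; so whatever [cokm m] kills, g kills as
    well. *)
Lemma mono_kernel A B (m : hom A B) : is_mono m -> is_kernel (cokm m) m.
Proof.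
move=> mm; have [D [g gm]] := mono_normal mm; apply: kernelI => //.
  exact: (cokP m).1.
move=> T t mt0; apply: (kernel_lift gm).
by have [g' <-] := cokernel_desc (cokP m) gm.1; rewrite -compA mt0 compm0.
Qed.

Lemma epi_cokernel A B (e : hom A B) : is_epi e -> is_cokernel (kerm e) e.
Proof.
move=> me; have [D [g ge]] := epi_conormal me; apply: cokernelI => //.
  exact: (kerP e).1.
move=> T t te0; apply: (cokernel_desc ge).
by have [g' <-] := kernel_lift (kerP e) ge.1; rewrite compA te0 comp0m.
Qed.

Lemma kernel_ses A B D (m : hom A B) (e : hom B D) :
  is_epi e -> is_kernel e m -> short_exact m e.
Proof.
move=> ee km; split=> //; apply: cokernelI => //; first exact: km.1.
move=> T g gm0; apply: (cokernel_desc (epi_cokernel ee)).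
have [u <-] := kernel_lift km (kerP e).1.
by rewrite compA gm0 comp0m.
Qed.

Lemma mono_epi_iso A B (f : hom A B) : is_mono f -> is_epi f -> is_iso f.
Proof.
move=> fm fe; have [|u e] := kernel_lift (g := idm B) (mono_kernel fm).
  by rewrite compm1; apply: (proj1 (epiP f) fe); exact: (cokP f).1.
by exists u; split=> //; apply: fm; rewrite compA e comp1m compm1.
Qed.

(** The image is the kernel of the cokernel. If w kills p, then f factors through the mono
    [i \oc kerm w], whose cokernel map therefore kills i. Hence i lifts through this mono, [kerm w]
    is a split epi, and w = 0. *)
Lemma image_fact A B (f : hom A B) : exists (I : C) (i : hom I B) (p : hom A I),
  [/\ is_kernel (cokm f) i, is_epi p & i \oc p = f].
Proof.
set i := kerm (cokm f); exists _, i.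
have [p e] := kernel_lift (kerP (cokm f)) (cokP f).1.
exists p; split=> //; first exact: kerP.
apply/epiP => W w wp0.
have [p' ep'] := kernel_lift (kerP w) wp0.
have mm : is_mono (i \oc kerm w) by apply: mono_comp; apply: kerm_mono.
have kc := mono_kernel mm.
have [|c' ec'] := cokernel_desc (g := cokm (i \oc kerm w)) (cokP f).
  by move: kc.1 => kc0; rewrite -[X in _ \oc X = 0]e -ep' (compA i) compA kc0 comp0m.
have [|t et] := kernel_lift (g := i) kc; first by rewrite -ec' -compA (kerP _).1 compm0.
have {}et : kerm w \oc t = idm _.
  by apply: (kerm_mono (f := cokm f)); rewrite compA et compm1.
by rewrite -(compm1 w) -et compA (kerP w).1 comp0m.
Qed.

(* Epimorphisms are stable under pullback: this lets one argue with
   generalized elements T -> A, up to replacing T by an epimorphic cover. *)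
Lemma epi_lift A B T (e : hom A B) (b : hom T B) : is_epi e ->
  exists (T' : C) (p : hom T' T) (a : hom T' A), is_epi p /\ e \oc a = b \oc p.
Proof.
(* The kernel of h is the pullback of e and b, and h is epi because it restricts to e on A. *)
move=> ee; set h := e \oc pr1 A T - b \oc pr2 A T.
have h1 : h \oc in1 A T = e.
  by rewrite compDl compNl -!compA pr1in1 pr2in1 compm0 subr0 compm1.
have he : is_epi h by apply: (@epi_cancel _ _ _ _ _ _ (in1 A T)); rewrite h1.
exists _, (pr2 A T \oc kerm h), (pr1 A T \oc kerm h); split; last first.
  by apply/eqP; rewrite -subr_eq0 !compA -compNl -compDl (kerP h).1.
(* A map w with [w \oc pr2] zero on the kernel of h makes [w \oc pr2] factor as v after h;
   restricting to A gives v after e equal to 0, so v = 0 and w = 0. *)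
apply/epiP => W w; rewrite compA => e0.
have [v ev] := cokernel_desc (epi_cokernel he) e0.
have v0 : v = 0.
  by apply: (proj1 (epiP e) ee); rewrite -h1 compA ev -compA pr2in1 compm0.
by rewrite -(compm1 w) -(pr2in2 A T) compA -ev v0 !comp0m.
Qed.

Lemma epi_liftP A B (e : hom A B) :
  (forall T (b : hom T B), exists (T' : C) (p : hom T' T) (a : hom T' A),
    is_epi p /\ e \oc a = b \oc p) -> is_epi e.
Proof.
move=> /(_ _ (idm B)) [T' [p [a [pe]]]]; rewrite comp1m => e1.
by apply: (@epi_cancel _ _ _ _ _ _ a); rewrite e1.
Qed.

(** Exactness at B in generalized elements: the kernel of g lies in the image of f. That g after f
    is zero is stated separately; for complexes it is [cdd]. *)
Definition exact A B D (f : hom A B) (g : hom B D) :=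
  forall T (x : hom T B), g \oc x = 0 ->
    exists (T' : C) (p : hom T' T) (y : hom T' A), is_epi p /\ f \oc y = x \oc p.

Lemma exact_coker_mono A B D (f : hom A B) (g : hom B D) :
  g \oc f = 0 -> exact f g ->
  exists2 j : hom (cok f) D, is_mono j & j \oc cokm f = g.
Proof.
move=> gf0 fg; have [j ej] := cokernel_desc (cokP f) gf0; exists j => //.
apply/monoP => T t jt0.
have [T1 [p [b [pe e1]]]] := epi_lift t (@cokm_epi _ _ f).
have [|T2 [q [a [qe e2]]]] := fg T1 b.
  by rewrite -ej -compA e1 compA jt0 comp0m.
apply: (proj1 (epiP _) (epi_comp pe qe)).
by rewrite compA -e1 -compA -e2 compA (cokP f).1 comp0m.
Qed.

Lemma exact_kerP A B D (f : hom A B) (g : hom B D) (u : hom A (ker g)) :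
  kerm g \oc u = f -> exact f g <-> is_epi u.
Proof.
move=> e; split=> [fg|ue].
  apply: epi_liftP => T b; have [|T' [p [y [pe e1]]]] := fg T (kerm g \oc b).
    by rewrite compA (kerP g).1 comp0m.
  exists T', p, y; split=> //; apply: (kerm_mono (f := g)).
  by rewrite !compA e.
move=> T x gx0; have [x' <-] := kernel_lift (kerP g) gx0.
have [T' [p [y [pe e1]]]] := epi_lift x' ue.
by exists T', p, y; rewrite -e -!compA e1.
Qed.

Lemma is_zero_cok A B (f : hom A B) : is_zero (cok f) <-> is_epi f.
Proof.
split=> [c0|fe]; last first.
  apply: (is_zeroP _).2; apply: (proj1 (epiP _) (@cokm_epi _ _ f)).
  by rewrite comp1m; apply: (proj1 (epiP _) fe); exact: (cokP f).1.
apply/epiP => T u uf0; have [v <-] := cokernel_desc (cokP f) uf0.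
by rewrite ((c0 T).1 v) comp0m.
Qed.

Lemma simple_epi A S (f : hom A S) : is_simple S -> f <> 0 -> is_epi f.
Proof.
move=> [_ H] f0; have [I [i [p [ki pe e]]]] := image_fact f.
have [I0|ii] := H I i (kernel_mono ki).
  by case: f0; rewrite -e ((I0 S).1 i) comp0m.
by rewrite -e; apply: epi_comp => //; apply: iso_epi.
Qed.

Lemma ses_epi A B D (m : hom A B) (e : hom B D) : short_exact m e -> is_epi e.
Proof. by move=> [_ /cokernel_epi]. Qed.

Lemma ses_mono A B D (m : hom A B) (e : hom B D) : short_exact m e -> is_mono m.
Proof. by move=> [/kernel_mono]. Qed.

Lemma has_length0 Y n : has_length Y n -> is_zero Y -> n = 0%N.
Proof.
case=> // Y' Y0 S m' m e se [S0 _] _ /(is_zero_epi (ses_epi se)).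
by case/S0.
Qed.

(** Additivity of length, by induction on a composition series of Y with top quotient S. If e kills
    u, then U lies in Y' and S is a quotient of Q. Otherwise U maps onto S, with kernel in Y', and Q
    is already a quotient of Y'. *)
Lemma has_length_split Y n : has_length Y n ->
  forall U Q (u : hom U Y) (q : hom Y Q), short_exact u q ->
  exists a b, [/\ has_length U a, has_length Q b & (a + b = n)%N].
Proof.
elim=> {Y n} [Y Y0|Y' Y S n m e se Ss Y'n IH] U Q u q uq.
  exists 0%N, 0%N; split=> //; apply: Length0.
    exact: is_zero_mono (ses_mono uq) Y0.
  exact: is_zero_epi (ses_epi uq) Y0.
have [eu0|eu0] := pselect (e \oc u = 0).
  have [u' eu'] := kernel_lift se.1 eu0.
  have [e' ee'] := cokernel_desc uq.2 eu0.
  have e'e : is_epi e'.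
    by apply: (@epi_cancel _ _ _ _ _ _ q); rewrite ee'; apply: ses_epi se.
  have [|q' eq'] := kernel_lift (g := q \oc m) (kerP e').
    by rewrite compA ee' se.1.1.
  have [|a [b [Ua Qb ab]]] := IH U _ u' q'.
    apply: kernel_ses.
      apply: epi_liftP => T z.
      have [T' [p [y [pe e1]]]] := epi_lift (kerm e' \oc z) (ses_epi uq).
      have [|y' ey'] := kernel_lift (g := y) se.1.
        by rewrite -ee' -compA e1 !compA (kerP _).1 !comp0m.
      exists T', p, y'; split=> //; apply: (kerm_mono (f := e')).
      by rewrite compA eq' -compA ey' e1 compA.
    apply: kernelI.
    - by apply: (@mono_cancel _ _ _ _ _ m); rewrite eu'; apply: ses_mono uq.
    - apply: (kerm_mono (f := e')).
      by rewrite compA eq' -compA eu' compm0 uq.1.1.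
    - move=> T g qg0; have [|x ex] := kernel_lift (g := m \oc g) uq.1.
        by rewrite compA -eq' -compA qg0 compm0.
      by exists x; apply: (ses_mono se); rewrite compA eu'.
  exists a, b.+1; split=> //; last by rewrite addnS ab.
  exact: LengthS (kernel_ses e'e (kerP e')) Ss Qb.
have eue := simple_epi Ss eu0.
have [|v ev] := kernel_lift (g := u \oc kerm (e \oc u)) se.1.
  by rewrite compA (kerP _).1.
have [|a [b [Ua Qb ab]]] := IH _ Q v (q \oc m).
  apply: kernel_ses.
    apply: epi_liftP => T z.
    have [T1 [p [y [pe e1]]]] := epi_lift z (ses_epi uq).
    have [T2 [r [x [re e2]]]] := epi_lift (e \oc y) eue.
    have [|y' ey'] := kernel_lift (g := y \oc r - u \oc x) se.1.
      by rewrite compDr compNr !compA e2 subrr.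
    exists T2, (p \oc r), y'; split; first exact: epi_comp.
    by rewrite -compA ey' compDr compNr !compA uq.1.1 comp0m subr0 e1.
  apply: kernelI.
  - apply: (@mono_cancel _ _ _ _ _ m); rewrite ev.
    by apply: mono_comp; [exact: ses_mono uq|exact: kerm_mono].
  - by rewrite -compA ev compA uq.1.1 comp0m.
  - move=> T g; rewrite -compA => qg0.
    have [x ex] := kernel_lift uq.1 qg0.
    have [|x' ex'] := kernel_lift (g := x) (kerP (e \oc u)).
      by rewrite -compA ex compA se.1.1 comp0m.
    by exists x'; apply: (ses_mono se); rewrite compA ev -compA ex'.
exists a.+1, b; split=> //; last by rewrite addSn ab.
exact: LengthS (kernel_ses eue (kerP _)) Ss Ua.
Qed.

Lemma has_length_simple S n : is_simple S -> has_length S n -> n = 1%N.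
Proof.
move=> [S0 H] Sn; case: Sn S0 H => [Y /[swap] /[apply] //|].
move=> Y' Y S' {}n m e se [S'0 _] Y'n Y0 H.
have [Y'0|mi] := H _ _ (ses_mono se); first by rewrite (has_length0 Y'n Y'0).
case: S'0; apply/is_zeroP/(proj1 (epiP _) (ses_epi se)).
by rewrite comp1m; apply: (proj1 (epiP _) (iso_epi mi)); exact: se.1.1.
Qed.

Lemma has_lengthSP Y n : has_length Y n.+1 ->
  exists Y' S (m : hom Y' Y) (e : hom Y S),
    [/\ short_exact m e, is_simple S & has_length Y' n].
Proof.
move E: n.+1 => z Yz; case: Yz E => // Y' {}Y S {}z u e se Ss Y'z [->].
by exists Y', S, u, e.
Qed.

(** Jordan-Hoelder: split the first series along the top step of the second one and induct on the
    second length. *)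
Lemma has_length_inj Y n m : has_length Y n -> has_length Y m -> n = m.
Proof.
elim: m => [|m IH] in Y n *.
  move=> Yn; move E: 0%N => z Yz; case: Yz E Yn => // Y0 Y00 _ Yn.
  exact: has_length0 Yn Y00.
move=> Yn /has_lengthSP [Y' [S [u [e [se Ss Y'm]]]]].
have [a [b [Y'a Sb <-]]] := has_length_split Yn se.
by rewrite (IH _ _ Y'a Y'm) (has_length_simple Ss Sb) addn1.
Qed.

End Abelian.

(** * Duality and exactness of the tensor product *)

Lemma comp_eql (k : fieldType) (C : linCat k) (A B B' D E : C)
    (g : hom B D) (f : hom A B) (g' : hom B' D) (f' : hom A B') (r : hom E A) :
  g \oc f = g' \oc f' -> g \oc (f \oc r) = g' \oc (f' \oc r).
Proof. by rewrite !compA => ->. Qed.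

Lemma comp_eql1 (k : fieldType) (C : linCat k) (A B D E : C)
    (g : hom B D) (f : hom A B) (h : hom A D) (r : hom E A) :
  g \oc f = h -> g \oc (f \oc r) = h \oc r.
Proof. by rewrite compA => ->. Qed.

Lemma compKV (k : fieldType) (C : linCat k) (A B E : C)
    (g : hom B A) (f : hom A B) (r : hom E A) :
  g \oc f = idm A -> g \oc (f \oc r) = r.
Proof. by rewrite compA => ->; rewrite comp1m. Qed.

Section Transposition.
Context (k : fieldType) (C : monAbCat k).
Implicit Types A B D : C.

Lemma ascV_nat A A' B B' D D' (f : hom A A') (g : hom B B') (h : hom D D') :
  ascV A' B' D' \oc (f \ot (g \ot h)) = (f \ot g) \ot h \oc ascV A B D.
Proof.
by apply: asc_mono; rewrite !compA ascVK comp1m asc_nat -compA ascVK compm1.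
Qed.

Lemma lunV_nat A A' (f : hom A A') :
  lunV A' \oc f = idm unit_ob \ot f \oc lunV A.
Proof.
by rewrite -[LHS]compm1 -(lunVK A) !compA -(compA (lunV A')) -lun_nat compA
  lunK comp1m.
Qed.

Lemma runV_nat A A' (f : hom A A') :
  runV A' \oc f = f \ot idm unit_ob \oc runV A.
Proof.
by rewrite -[LHS]compm1 -(runVK A) !compA -(compA (runV A')) -run_nat compA
  runK comp1m.
Qed.

Lemma tensm_split A A' B B' (f : hom A A') (g : hom B B') :
  f \ot g = (f \ot idm B') \oc (idm A \ot g).
Proof. by rewrite -tensm_comp comp1m compm1. Qed.

Lemma tensm_splitr A A' B B' (f : hom A A') (g : hom B B') :
  f \ot g = (idm A' \ot g) \oc (f \ot idm B).
Proof. by rewrite -tensm_comp comp1m compm1. Qed.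

Lemma tensm_swap A A' B B' (f : hom A A') (g : hom B B') :
  (f \ot idm B') \oc (idm A \ot g) = (idm A' \ot g) \oc (f \ot idm B).
Proof. by rewrite -tensm_split -tensm_splitr. Qed.

Lemma pentagonV A B D E : ascV A B (D \oX E) \oc
    ((idm A \ot asc B D E) \oc asc A (B \oX D) E) =
  asc (A \oX B) D E \oc (ascV A B D \ot idm E).
Proof.
have -> : (idm A \ot asc B D E) \oc asc A (B \oX D) E =
    asc A B (D \oX E) \oc asc (A \oX B) D E \oc (ascV A B D \ot idm E).
  by rewrite pentagon -!compA -tensm_compl ascVK tensm1 compm1.
by rewrite !compA ascK comp1m.
Qed.

Lemma pentagonV_comp A B D E T (r : hom T ((A \oX (B \oX D)) \oX E)) :
  ascV A B (D \oX E) \oc ((idm A \ot asc B D E) \oc (asc A (B \oX D) E \oc r)) =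
  asc (A \oX B) D E \oc ((ascV A B D \ot idm E) \oc r).
Proof. by rewrite (compA (idm A \ot _)) compA pentagonV -compA. Qed.

Lemma pentagonW_comp A B D E T (r : hom T (((A \oX B) \oX D) \oX E)) :
  (idm A \ot ascV B D E) \oc (asc A B (D \oX E) \oc (asc (A \oX B) D E \oc r)) =
  asc A (B \oX D) E \oc ((asc A B D \ot idm E) \oc r).
Proof.
rewrite (compA (asc A _ _)) pentagon -!compA compKV //.
by rewrite -tensm_compr ascK tensm1.
Qed.

Lemma tensmDl A A' B B' (f f' : hom A A') (g : hom B B') :
  (f + f') \ot g = f \ot g + f' \ot g.
Proof. by have := tensm_linl 1 f f' g; rewrite !scale1r. Qed.

Lemma tens_isomorphic A A' B B' :
  isomorphic A A' -> isomorphic B B' -> isomorphic (A \oX B) (A' \oX B').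
Proof.
move=> [f [g [gf fg]]] [f' [g' [gf' fg']]]; exists (f \ot f'), (g \ot g').
by rewrite -!tensm_comp gf fg gf' fg' !tensm1.
Qed.

Lemma asc_isomorphic A B D : isomorphic ((A \oX B) \oX D) (A \oX (B \oX D)).
Proof. by exists (asc A B D), (ascV A B D); rewrite ascK ascVK. Qed.

Lemma lun_isomorphic A : isomorphic (unit_ob \oX A) A.
Proof. by exists (lun A), (lunV A); rewrite lunK lunVK. Qed.

Lemma run_isomorphic A : isomorphic (A \oX unit_ob) A.
Proof. by exists (run A), (runV A); rewrite runK runVK. Qed.

Context (X Y : C) (e : hom (Y \oX X) unit_ob) (c : hom unit_ob (X \oX Y)).

(** With [trr], the adjunction between tensoring with Y and tensoring with X on the left. *)
Definition trl A B (phi : hom A (X \oX B)) : hom (Y \oX A) B :=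
  lun B \oc (e \ot idm B) \oc ascV Y X B \oc (idm Y \ot phi).

Definition trr A B (f : hom (Y \oX A) B) : hom A (X \oX B) :=
  (idm X \ot f) \oc asc X Y A \oc (c \ot idm A) \oc lunV A.

Lemma trl_compr A A' B (phi : hom A (X \oX B)) (a : hom A' A) :
  trl (phi \oc a) = trl phi \oc (idm Y \ot a).
Proof. by rewrite /trl tensm_compr !compA. Qed.

Lemma trr_compl A B B' (f : hom (Y \oX A) B) (b : hom B B') :
  trr (b \oc f) = (idm X \ot b) \oc trr f.
Proof. by rewrite /trr tensm_compr !compA. Qed.

Lemma trl_compl A B B' (phi : hom A (X \oX B)) (b : hom B B') :
  trl (idm X \ot b \oc phi) = b \oc trl phi.
Proof.
rewrite /trl tensm_compr -!compA (comp_eql _ (ascV_nat (idm Y) (idm X) b)) tensm1.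
by rewrite (comp_eql _ (tensm_swap e b)) (comp_eql _ (lun_nat b)).
Qed.

Lemma trr_compr A A' B (f : hom (Y \oX A) B) (a : hom A' A) :
  trr (f \oc (idm Y \ot a)) = trr f \oc a.
Proof.
rewrite /trr tensm_compr -!compA lunV_nat (comp_eql _ (esym (asc_nat (idm X) (idm Y) a))).
by rewrite tensm1 (comp_eql _ (esym (tensm_swap c a))).
Qed.

Lemma trl0 A B : trl (0 : hom A (X \oX B)) = 0.
Proof. by rewrite /trl tensm0r compm0. Qed.

Lemma trr0 A B : trr (0 : hom (Y \oX A) B) = 0.
Proof. by rewrite /trr tensm0r !comp0m. Qed.

Hypothesis dualXY : is_left_dual e c.

(** This is the second zigzag equation tensored with A on the right; the pentagon and naturality
    rearrange the associators. The general case [trrK] follows by naturality. *)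
Lemma trl_unit A : trl (trr (idm (Y \oX A))) = idm _.
Proof.
have gg : (idm Y \ot lun A \oc asc Y unit_ob A) \oc
    (ascV Y unit_ob A \oc (idm Y \ot lunV A)) = idm _.
  by rewrite -compA (compKV _ (ascVK _ _ _)) -tensm_compr lunVK tensm1.
have cancel_gg f : f \oc (idm Y \ot lun A \oc asc Y unit_ob A) =
    (idm Y \ot lun A \oc asc Y unit_ob A) -> f = idm _.
  by move=> E; rewrite -(compm1 f) -gg compA E.
apply: cancel_gg; rewrite [RHS]triangle -dualXY.2.
rewrite /trl /trr tensm1 comp1m !tensm_compr !tensm_compl -!compA.
rewrite (compKV _ (_ : (idm Y \ot lunV A) \oc (idm Y \ot lun A) = _)); last first.
  by rewrite -tensm_compr lunK tensm1.
rewrite -asc_nat pentagonV_comp.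
rewrite -(tensm1 Y A) (comp_eql _ (esym (asc_nat e (idm Y) (idm A)))) -lun_tens.
by rewrite -!compA.
Qed.

Lemma trr_counit B : trr (trl (idm (X \oX B))) = idm _.
Proof.
have cancel_gg f : f \oc (lun (X \oX B) \oc asc unit_ob X B) =
    lun (X \oX B) \oc asc unit_ob X B -> f = idm _.
  move=> E; rewrite -(compm1 f) -(lunVK (X \oX B)) -(compm1 (lun _)).
  by rewrite -(ascVK unit_ob X B) -!compA compA compA -(compA f) E -!compA
    (compKV _ (ascVK _ _ _)).
apply: cancel_gg; rewrite [RHS]lun_tens -dualXY.1.
rewrite /trl /trr tensm1 compm1 !tensm_compr !tensm_compl -!compA.
rewrite (compKV _ (lunK _)) -triangle.
rewrite -(tensm1 X B) -(asc_nat c (idm X) (idm B)).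
rewrite pentagonW_comp -(comp_eql _ (asc_nat (idm X) e (idm B))).
by rewrite -!compA.
Qed.

Lemma trrK A B (f : hom (Y \oX A) B) : trl (trr f) = f.
Proof. by rewrite -(compm1 f) trr_compl trl_compl trl_unit. Qed.

Lemma trlK A B (phi : hom A (X \oX B)) : trr (trl phi) = phi.
Proof. by rewrite -(comp1m phi) trl_compr trr_compr trr_counit. Qed.

Lemma trl_eq0 A B (phi : hom A (X \oX B)) : trl phi = 0 -> phi = 0.
Proof. by move=> e0; rewrite -(trlK phi) e0 trr0. Qed.

Lemma trr_eq0 A B (f : hom (Y \oX A) B) : trr f = 0 -> f = 0.
Proof. by move=> e0; rewrite -(trrK f) e0 trl0. Qed.

(** Tensoring with Y is a left adjoint, so it preserves epimorphisms. *)
Lemma dual_tens_epi A B (g : hom A B) : is_epi g -> is_epi (idm Y \ot g).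
Proof.
move=> /epiP ge; apply/epiP => T w w0; apply: trr_eq0; apply: ge.
by rewrite -trr_compr w0 trr0.
Qed.

(** Tensoring with X is a right adjoint, so it preserves kernels. *)
Lemma dual_tens_kernel A B K (f : hom A B) (m : hom K A) :
  is_kernel f m -> is_kernel (idm X \ot f) (idm X \ot m).
Proof.
move=> km; apply: kernelI.
- apply/monoP => T w w0; apply: trl_eq0.
  by apply: (proj1 (monoP _) (kernel_mono km)); rewrite -trl_compl w0 trl0.
- by rewrite -tensm_compr km.1 tensm0r.
- move=> T t t0; have [|u eu] := kernel_lift (g := trl t) km.
    by rewrite -trl_compl t0 trl0.
  by exists (trr u); rewrite -trr_compl eu trlK.
Qed.

Lemma trl_asc A B T (phi : hom A (X \oX B)) :
  trl (asc X B T \oc (phi \ot idm T)) = (trl phi \ot idm T) \oc ascV Y A T.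
Proof.
apply: asc_epi; rewrite -!compA ascK compm1 /trl !tensm_compr !tensm_compl -!compA.
rewrite -asc_nat pentagonV_comp -(tensm1 B T).
by rewrite (comp_eql _ (esym (asc_nat e (idm B) (idm T)))) (comp_eql1 _ (lun_tens _ _)).
Qed.

End Transposition.

Section Reverse.
Context (k : fieldType) (C : monAbCat k).

(* Turns statements on left tensoring into statements on right tensoring. *)
Definition rev_mon : monAbCat k.
Proof.
refine (@MonAbCat k (mon_ab C) unit_ob (fun A B => B \oX A)
  (fun A A' B B' f g => g \ot f) _ _ _ _
  (fun A B D => ascV D B A) (fun A B D => asc D B A) _ _ _
  (@run k C) (@runV k C) _ _ _ (@lun k C) (@lunV k C) _ _ _ _ _).
- by move=> A B; rewrite tensm1.
- by move=> *; rewrite tensm_comp.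
- by move=> *; rewrite tensm_linr.
- by move=> *; rewrite tensm_linl.
- by move=> *; rewrite ascVK.
- by move=> *; rewrite ascK.
- by move=> *; rewrite ascV_nat.
- by move=> *; rewrite runK.
- by move=> *; rewrite runVK.
- by move=> *; rewrite run_nat.
- by move=> *; rewrite lunK.
- by move=> *; rewrite lunVK.
- by move=> *; rewrite lun_nat.
- move=> A B D E; apply: asc_mono; apply: asc_mono.
  rewrite (compA (asc _ _ _) (ascV _ _ _) (ascV _ _ _)) ascVK comp1m ascVK.
  rewrite compA pentagon -!compA (compKV (g := asc E D B \ot idm A)); last first.
    by rewrite -tensm_compl ascVK tensm1.
  by rewrite (compKV _ (ascVK _ _ _)) -tensm_compr ascVK tensm1.
- by move=> A B; rewrite -triangle -compA ascVK compm1.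
Defined.

Lemma rev_left_dual (X Y : C) (e : hom (Y \oX X) unit_ob) (c : hom unit_ob (X \oX Y)) :
  is_left_dual e c -> @is_left_dual k rev_mon Y X e c.
Proof. by move=> [H1 H2]; split. Qed.

End Reverse.

(** * Exactness of the tensor product, simplicity of the unit, faithfulness *)

Section TensorExact.
Context (k : fieldType) (C : tensorCat k).
Implicit Types A B D X Y : C.

(** Y is a left dual of [rdual Y], so tensoring with it is a left adjoint. Since both duals exist,
    all four such statements, on either side, hold. *)
Lemma tensl_epi Y A B (g : hom A B) : is_epi g -> is_epi (idm Y \ot g).
Proof. by move=> ge; apply: (dual_tens_epi (rdualP Y)). Qed.

Lemma tensl_kernel Y A B K (f : hom A B) (m : hom K A) :
  is_kernel f m -> is_kernel (idm Y \ot f) (idm Y \ot m).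
Proof. by move=> km; apply: (dual_tens_kernel (ldualP Y)). Qed.

Lemma tensr_epi Y A B (g : hom A B) : is_epi g -> is_epi (g \ot idm Y).
Proof.
by move=> ge; apply: (dual_tens_epi (C := rev_mon C) (rev_left_dual (ldualP Y))).
Qed.

Lemma tensr_kernel Y A B K (f : hom A B) (m : hom K A) :
  is_kernel f m -> is_kernel (f \ot idm Y) (m \ot idm Y).
Proof.
by move=> km; apply: (dual_tens_kernel (C := rev_mon C) (rev_left_dual (rdualP Y))).
Qed.

Lemma tensl_ses Y A B D (m : hom A B) (f : hom B D) :
  short_exact m f -> short_exact (idm Y \ot m) (idm Y \ot f).
Proof.
move=> se; apply: kernel_ses; first exact: tensl_epi (ses_epi se).
exact: tensl_kernel se.1.
Qed.

Lemma tensr_ses Y A B D (m : hom A B) (f : hom B D) :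
  short_exact m f -> short_exact (m \ot idm Y) (f \ot idm Y).
Proof.
move=> se; apply: kernel_ses; first exact: tensr_epi (ses_epi se).
exact: tensr_kernel se.1.
Qed.

Lemma tensl_exact Y A B D (f : hom A B) (g : hom B D) :
  g \oc f = 0 -> exact f g -> exact (idm Y \ot f) (idm Y \ot g).
Proof.
move=> gf0 fg; have [u eu] := kernel_lift (kerP g) gf0.
have ue : is_epi u by apply/(exact_kerP eu).
move=> T x gx0; have [x' <-] := kernel_lift (tensl_kernel Y (kerP g)) gx0.
have [T' [p [y [pe e1]]]] := epi_lift x' (tensl_epi (Y := Y) ue).
by exists T', p, y; rewrite -eu tensm_compr -!compA e1.
Qed.

Lemma unit_nonzero : ~ is_zero (unit_ob : C).
Proof.
move=> /is_zeroP e0; have [f fK _] := end_one C.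
have := congr1 f (_ : 1 *: idm (unit_ob : C) = 0 *: idm _); rewrite !fK.
by rewrite e0 !scaler0 => /(_ erefl) /eqP; rewrite oner_eq0.
Qed.

Lemma end_unit_inv (f : hom (unit_ob : C) unit_ob) : f <> 0 ->
  exists g : hom (unit_ob : C) unit_ob, g \oc f = idm _.
Proof.
have [h _ hK] := end_one C; rewrite -(hK f); move: (h f) => a.
have [->|a0 _] := eqVneq a 0; first by rewrite scale0r.
exists (a^-1 *: idm _); rewrite compZl compZr comp1m scalerA mulVf //.
by rewrite scale1r.
Qed.

Lemma ev_eq0 X : ev X = 0 -> is_zero X.
Proof.
move=> e0; apply/is_zeroP.
apply: (proj1 (epiP _) (iso_epi (f := lun X) _)).
  by exists (lunV X); rewrite lunK lunVK.
by rewrite comp1m -(ldualP X).1 e0 tensm0r !(comp0m, compm0).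
Qed.

(* From a surjection of the unit onto a simple object S one gets a nonzero map
   S^* (x) S -> S, hence an isomorphism, and a nonzero endomorphism of the unit
   factoring through S. *)
Lemma unit_simple : is_simple (unit_ob : C).
Proof.
have [n un] := flen (unit_ob : C).
case: n un => [|n] un.
  move E: 0%N (unit_ob : C) un unit_nonzero => z Z Zz; by case: Zz E => // Y0 ? _ /[apply].
have [Y' [S [m [e [se Ss _]]]]] := has_lengthSP un.
have ee := ses_epi se.
(* The dual of e, up to unit isomorphisms; it is mono because e is epi. *)
set h : hom (ldual S) unit_ob := ev S \oc (idm _ \ot e) \oc runV _.
have hm : is_mono h.
  apply/monoP => T u; rewrite /h -!compA runV_nat => hu0.
  apply: ev_inj; apply: (proj1 (epiP _) (tensl_epi (Y := T) ee)).
  apply: (proj1 (epiP _) (iso_epi (f := runV T) _)).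
    by exists (run T); rewrite runK runVK.
  by rewrite -!compA in hu0 *; rewrite -hu0 !compA -!(compA (ev S)) tensm_swap.
set q := lun S \oc (h \ot idm S).
have qm : is_mono q.
  apply: mono_comp; last exact: kernel_mono (tensr_kernel S (mono_kernel hm)).
  by apply: iso_mono; exists (lunV S); rewrite lunK lunVK.
have [T0|[t [tq qt]]] := Ss.2 _ _ qm.
  by case: Ss.1; apply: ev_eq0; rewrite -(compm1 (ev S)) (is_zeroP _).1 // compm0.
have [|g eg] := end_unit_inv (f := ev S \oc t \oc e).
  move=> /(proj1 (epiP _) ee) et0; apply: Ss.1; apply: ev_eq0.
  by rewrite -(compm1 (ev S)) -tq compA et0 comp0m.
have em : is_mono e.
  apply: (@mono_cancel _ _ _ _ _ (g \oc (ev S \oc t))).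
  by rewrite -compA eg => T u v; rewrite !comp1m.
apply: simple_iso Ss; apply: isomorphic_sym; exists e; exact: mono_epi_iso.
Qed.

Lemma unit_epi X (h : hom X unit_ob) : h <> 0 -> is_epi h.
Proof. exact: simple_epi unit_simple. Qed.

(** As the unit is simple, a nonzero g is epi, and so is its product with Q; if that product were
    zero, Q would be zero. *)
Lemma tensl_faithful1 Q X (g : hom X unit_ob) :
  ~ is_zero Q -> idm Q \ot g = 0 -> g = 0.
Proof.
move=> Q0 Qg; apply: contrapT => /unit_epi /(tensl_epi (Y := Q)).
rewrite Qg => /epiP z; apply: Q0; apply/is_zeroP.
apply: (proj1 (epiP _) (iso_epi (f := run Q) _)).
  by exists (runV Q); rewrite runK runVK.
by rewrite comp1m; apply: z; rewrite compm0.
Qed.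

Lemma tensr_faithful1 P X (g : hom X unit_ob) :
  ~ is_zero P -> g \ot idm P = 0 -> g = 0.
Proof.
move=> Q0 Qg; apply: contrapT => /unit_epi /(tensr_epi (Y := P)).
rewrite Qg => /epiP z; apply: Q0; apply/is_zeroP.
apply: (proj1 (epiP _) (iso_epi (f := lun P) _)).
  by exists (lunV P); rewrite lunK lunVK.
by rewrite comp1m; apply: z; rewrite compm0.
Qed.

(** The map [ev A \ot idm B] factors through the product of the dual of A with A (x) B. If A (x) B
    is zero, faithfulness gives [ev A = 0], hence A is zero. *)
Lemma tens_nonzero A B : ~ is_zero A -> ~ is_zero B -> ~ is_zero (A \oX B).
Proof.
move=> A0 B0 /is_zeroP AB0; apply: A0; apply: ev_eq0; apply: (tensr_faithful1 B0).
have -> : ev A \ot idm B = (ev A \ot idm B) \oc ascV _ _ _ \oc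
    (idm (ldual A) \ot idm (A \oX B)) \oc asc _ _ _.
  by rewrite tensm1 compm1 -compA ascK compm1.
by rewrite AB0 tensm0r compm0 comp0m.
Qed.

End TensorExact.

(** * Lengths *)

Section Length.
Context (k : fieldType) (C : tensorCat k).
Implicit Types A B D X Y S : C.

Lemma lenP Y : has_length Y (len Y).
Proof. by rewrite /len; case: cid. Qed.

Lemma lenE Y n : has_length Y n -> len Y = n.
Proof. exact: has_length_inj (lenP Y). Qed.

Lemma len_eq0 Y : len Y = 0%N <-> is_zero Y.
Proof.
split=> [Y0|Y0]; last exact/lenE/Length0.
have := lenP Y; rewrite Y0; move E: 0%N => z Yz.
by case: Yz E.
Qed.

Lemma len_gt0 Y : ~ is_zero Y -> (0 < len Y)%N.
Proof. by move=> Y0; rewrite lt0n; apply/eqP => /len_eq0. Qed.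

Lemma len_ses A B D (m : hom A B) (e : hom B D) :
  short_exact m e -> len B = (len A + len D)%N.
Proof.
move=> se; have [a [b [Aa Db <-]]] := has_length_split (lenP B) se.
by rewrite (lenE Aa) (lenE Db).
Qed.

Lemma len_iso A B : isomorphic A B -> len A = len B.
Proof.
move=> [f [g [gf fg]]]; have fi : is_iso g by exists f.
rewrite -[RHS](addn0) -(len_eq0 zob).2; last exact: zobP.
rewrite addnC; apply: len_ses; apply: (kernel_ses (m := 0) (e := f)).
  by apply: iso_epi; exists g.
apply: kernelI; last first.
- move=> T h fh; exists 0; rewrite compm0 -(comp1m h) -gf -compA fh.
  by rewrite compm0.
- exact: compm0.
- by apply/monoP => T u _; exact: (zobP T).2.
Qed.

(** Filter both factors by composition series: each product of two simple subquotients is nonzero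
    and contributes at least 1. *)
Lemma len_tens A B : (len A * len B <= len (A \oX B))%N.
Proof.
have H S n : ~ is_zero S -> forall D, has_length D n -> (n <= len (S \oX D))%N.
  move=> S0 D; elim=> {D n} // D' D Q n m e se [Q0 _] _ IH.
  rewrite (len_ses (tensl_ses S se)) -addn1 leq_add // len_gt0 //.
  exact: tens_nonzero.
elim: (lenP A) => {A} [//|A' A S n m e se [S0 _] _ IH].
by rewrite mulSn addnC (len_ses (tensr_ses B se)) leq_add // H //; apply: lenP.
Qed.

End Length.

(** * Pairs with scalar endomorphisms *)

Lemma dual_ev_inj (k : fieldType) (C : monAbCat k) (X Y : C)
    (e : hom (Y \oX X) unit_ob) (c : hom unit_ob (X \oX Y))
    (T : C) (u : hom T Y) : is_left_dual e c -> e \oc (u \ot idm X) = 0 -> u = 0.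
Proof.
move=> H e0; apply: (proj1 (epiP _) (iso_epi (f := run T) _)).
  by exists (runV T); rewrite runK runVK.
rewrite -run_nat -H.2 -!compA -tensm_swap -(tensm1 X Y).
rewrite (comp_eql _ (ascV_nat u (idm X) (idm Y))) (compA (e \ot _)).
by rewrite -tensm_compl e0 tensm0l comp0m compm0.
Qed.

Section Rigid.
Context (k : fieldType) (C : tensorCat k).
Implicit Types P Q T X Y Z : C.

(* The pair (Q, P), together with phi, has only scalar endomorphisms, in the
   sense internal to the right action of C on such pairs. *)
Definition rigid Y P Q (phi : hom Q (Y \oX P)) :=
  forall T (a : hom (Q \oX T) Q) (b : hom (P \oX T) P),
    phi \oc a = (idm Y \ot b) \oc asc Y P T \oc (phi \ot idm T) ->
    exists g : hom T unit_ob,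
      a = run Q \oc (idm Q \ot g) /\ b = run P \oc (idm P \ot g).

Lemma rigid_of_right Y P Q (phi : hom Q (Y \oX P)) T (a : hom (Q \oX T) Q)
    (g : hom T unit_ob) : is_mono phi ->
  phi \oc a = (idm Y \ot (run P \oc (idm P \ot g))) \oc asc Y P T \oc (phi \ot idm T) ->
  a = run Q \oc (idm Q \ot g).
Proof.
move=> phim e; apply: phim; rewrite e tensm_compr -!compA.
rewrite -(comp_eql _ (asc_nat (idm Y) (idm P) g)) (comp_eql1 _ (run_tens _ _)).
by rewrite tensm1 -tensm_swap (comp_eql _ (run_nat _)).
Qed.

(** When P is the unit, a map from P (x) T to P is the same as a map g from T to the unit, and b
    determines a because phi is mono. *)
Lemma rigid_unit Y P Q (phi : hom Q (Y \oX P)) :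
  is_mono phi -> isomorphic P unit_ob -> rigid phi.
Proof.
move=> phim [i [j [ji ij]]] T a b e.
set g := i \oc b \oc (j \ot idm T) \oc lunV T.
have bE : b = run P \oc (idm P \ot g).
  have im : is_mono i by apply: iso_mono; exists j.
  apply: im; rewrite compA -run_nat -compA tensm_swap -lun_run.
  rewrite (comp_eql _ (lun_nat g)) /g -!compA (compKV _ (lunK T)).
  by rewrite -tensm_compl ji tensm1 compm1.
exists g; split=> //; apply: rigid_of_right phim _.
by rewrite -bE.
Qed.

(** Rigidity restated for the transposed map f, the form in which kernels and cokernels of f can be
    used. *)
Lemma rigid_trl Y P Q (phi : hom Q (Y \oX P)) : rigid phi ->
  forall T (a : hom (Q \oX T) Q) (b : hom (P \oX T) P),
    let f := trl (ev Y) phi in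
    f \oc (idm _ \ot a) \oc asc _ Q T = b \oc (f \ot idm T) ->
    exists g : hom T unit_ob,
      a = run Q \oc (idm Q \ot g) /\ b = run P \oc (idm P \ot g).
Proof.
move=> R T a b f e; apply: R.
rewrite -[LHS](trlK (ldualP Y)) -[RHS](trlK (ldualP Y)); congr trr.
rewrite -compA trl_compr trl_compl trl_asc -/f compA -e -compA ascVK.
by rewrite compm1.
Qed.

(* Let Z be the cokernel of f and Z' its right dual.  The pair (0, b), where b is
   P (x) (Z' (x) P) -> (Z (x) Z') (x) P -> P, is compatible with f; by rigidity it
   is given by a single map g, and g = 0 because of the first component. *)
Lemma rigid_epi Y P Q (phi : hom Q (Y \oX P)) : rigid phi ->
  ~ is_zero P -> ~ is_zero Q -> is_epi (trl (ev Y) phi).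
Proof.
move=> R P0 Q0; set f := trl _ _.
pose e := cokm f; pose T := rdual (cok f) \oX P.
pose h : hom (P \oX rdual (cok f)) unit_ob := revl _ \oc (e \ot idm _).
pose b : hom (P \oX T) P := lun P \oc (h \ot idm P) \oc ascV _ _ _.
have [|g [g1 g2]] := rigid_trl R (T := T) (a := 0) (b := b).
  rewrite tensm0r compm0 comp0m /b /h -/f.
  have hf0 : h \oc (f \ot idm _) = 0.
    by rewrite /h -compA -tensm_compl (cokP f).1 tensm0l compm0.
  by rewrite -(tensm1 (rdual _) P) -!compA ascV_nat (compA (h \ot _)) -tensm_compl
    hf0 tensm0l comp0m compm0.
have g0 : g = 0.
  apply: (tensl_faithful1 Q0); apply: (iso_mono (f := run Q)).
    by exists (runV Q); rewrite runK runVK.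
  by rewrite -g1 compm0.
have h0 : h = 0.
  apply: (tensr_faithful1 P0); apply: (iso_mono (f := lun P)).
    by exists (lunV P); rewrite lunK lunVK.
  rewrite compm0 -[LHS]compm1 -(ascK P (rdual (cok f)) P) compA.
  by rewrite -[X in X \oc _]/b g2 g0 tensm0r compm0 comp0m.
(* Since h is the transpose of the cokernel map e under the duality of its target, h = 0 forces e =
   0. *)
apply/is_zero_cok/is_zeroP; apply: (proj1 (epiP _) (@cokm_epi _ _ _ _ f)).
by rewrite comp1m; apply: (dual_ev_inj (rdualP (cok f))).
Qed.

(** An endomorphism (a, b) of the kernel pair induces some c on P, because f (x) T is the cokernel
    of m (x) T. Rigidity of phi applied to (b, c) makes b scalar, and a follows since m is mono. *)
Lemma rigid_step Y P Q (phi : hom Q (Y \oX P)) Q' (m : hom Q' (ldual Y \oX Q)) :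
  rigid phi -> is_epi (trl (ev Y) phi) -> is_kernel (trl (ev Y) phi) m -> rigid m.
Proof.
move=> R fe km T a b e.
have se := tensr_ses T (kernel_ses fe km).
have [|c ec] := cokernel_desc (g := trl (ev Y) phi \oc (idm _ \ot b) \oc asc _ _ _) se.2.
  by rewrite -!(compA (trl _ _)) -e compA km.1 comp0m.
have [g [bE _]] := rigid_trl R (esym ec).
exists g; split=> //; apply: rigid_of_right (kernel_mono km) _.
by rewrite -bE.
Qed.

End Rigid.

(** * Acyclic complexes and duals *)

Section Acyclic.
Context (k : fieldType) (C : abCat k).
Implicit Types (K L M : cpx C).

Definition exact_at K i := exact (cd K (i + 1) i) (cd K i (i - 1)).

Definition acyclic K := forall i, exact_at K i.

Lemma exact_atE K i j a b : i = j -> a = j + 1 -> b = j - 1 ->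
  exact_at K i -> exact (cd K a j) (cd K j b).
Proof. by move=> <- -> ->. Qed.

Lemma homology_zeroP K n : is_zero (homology K n) <-> exact_at K n.
Proof.
rewrite /homology is_zero_cok; apply: iff_sym.
by apply: exact_kerP; apply: kliftE.
Qed.

Lemma homology_map_cok K L (f : chmap K L) n :
  homology_map f n \oc cokm (bnd K n) = cokm (bnd L n) \oc cycles_map f n.
Proof. exact: cdescE. Qed.

Lemma cycles_map_ker K L (f : chmap K L) n :
  kerm (cd L n (n - 1)) \oc cycles_map f n = f n \oc kerm (cd K n (n - 1)).
Proof. exact: kliftE. Qed.

Lemma homology_map_id K n : homology_map (chid K) n = idm _.
Proof.
apply: (@cokm_epi _ _ _ _ (bnd K n)); rewrite homology_map_cok comp1m.
rewrite -[RHS]compm1; congr (_ \oc _).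
apply: (kerm_mono (f := cd K n (n - 1))).
by rewrite cycles_map_ker comp1m compm1.
Qed.

Lemma homology_map_comp K L M (g : chmap L M) (f : chmap K L) n :
  homology_map (chcomp g f) n = homology_map g n \oc homology_map f n.
Proof.
apply: (@cokm_epi _ _ _ _ (bnd K n)); rewrite -compA !homology_map_cok.
rewrite compA homology_map_cok -compA; congr (_ \oc _).
apply: (kerm_mono (f := cd M n (n - 1))).
by rewrite [RHS]compA !cycles_map_ker -[RHS]compA cycles_map_ker compA.
Qed.

(** Homology inverts quasi-isomorphisms, so it extends to formal composites; [deq_homology] shows
    that it descends to the localization. *)
Fixpoint dhom_homology K L (u : dhom K L) n : hom (homology K n) (homology L n) :=
  match u with
  | DId K => idm _
  | DMap K L f => homology_map f n
  | DInv K L s hs => projT1 (cid (hs n))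
  | DComp K L M v u => dhom_homology v n \oc dhom_homology u n
  end.

Lemma deq_homology K L (u v : dhom K L) n :
  deq u v -> dhom_homology u n = dhom_homology v n.
Proof.
elim=> {K L u v} //=.
- by move=> K L u v w _ -> _ ->.
- by move=> K L M v v' u u' _ -> _ ->.
- by move=> *; rewrite comp1m.
- by move=> *; rewrite compm1.
- by move=> *; rewrite compA.
- by move=> K; rewrite homology_map_id.
- by move=> *; rewrite homology_map_comp.
- by move=> K L s hs; case: cid => g [].
- by move=> K L s hs; case: cid => g [].
Qed.

Lemma conc_zob_zero i : is_zero (conc (@zob k C) i).
Proof. by rewrite /= /conc_ob; case: ifP => _; exact: zobP. Qed.

Lemma is_zero_exact K i : is_zero (K i) -> exact_at K i.
Proof.
move=> K0 T x _; exists T, (idm T), 0; split; first exact: epi_id.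
by rewrite compm0 ((K0 T).2 x) comp0m.
Qed.

(** Homology is an invariant of the derived category; conversely, for acyclic K the zero map to the
    zero complex is a quasi-isomorphism. *)
Lemma derived_zeroP K : derived_iso K (conc (@zob k C)) <-> acyclic K.
Proof.
have Z n : is_zero (homology (conc (@zob k C)) n).
  by apply/homology_zeroP/is_zero_exact/conc_zob_zero.
split=> [[u [v [vu _]]] n|K0].
  apply/homology_zeroP/is_zeroP; have /= <- := deq_homology n vu.
  by rewrite ((Z n _).2 (dhom_homology u n)) compm0.
have s_comm i j : (0 : hom (K j) (conc (@zob k C) j)) \oc cd K i j =
    cd (conc (@zob k C)) i j \oc (0 : hom (K i) (conc (@zob k C) i)).
  by rewrite comp0m compm0.
pose s : chmap K (conc (@zob k C)) := ChMap s_comm.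
have hs : quasi_iso s.
  move=> n; have Kn := (homology_zeroP K n).2 (K0 n).
  exists 0; rewrite comp0m compm0 (is_zeroP _).1 //.
  by rewrite (is_zeroP _).1.
exists (DMap s), (DInv hs); split; [exact: deq_invl|exact: deq_invr].
Qed.

End Acyclic.

(** * Universal property, uniqueness and exactness of duals *)

Section Duals.
Context (k : fieldType) (C : monAbCat k).
Implicit Types A B D T X Y : C.

(** Together with [dual_ev_inj2], this says that evaluation represents maps from T (x) X to the
    unit; it is the adjunction for right tensoring. *)
Lemma dual_ev_surj X Y (e : hom (Y \oX X) unit_ob) (c : hom unit_ob (X \oX Y))
    T (w : hom (T \oX X) unit_ob) : is_left_dual e c ->
  exists u : hom T Y, e \oc (u \ot idm X) = w.
Proof.
move=> /rev_left_dual H.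
have := trrK H (A := T) (B := unit_ob) w.
set phi := trr _ _; rewrite /trl /= => <-; exists (lun Y \oc phi).
rewrite tensm_compl -!compA -lun_run -(comp_eql1 _ (lun_tens _ _)).
by rewrite (comp_eql _ (lun_nat e)).
Qed.

Lemma dual_ev_inj2 X Y (e : hom (Y \oX X) unit_ob) (c : hom unit_ob (X \oX Y))
    T (u v : hom T Y) : is_left_dual e c ->
  e \oc (u \ot idm X) = e \oc (v \ot idm X) -> u = v.
Proof.
move=> H E; apply/eqP; rewrite -subr_eq0; apply/eqP.
apply: (dual_ev_inj H); rewrite tensmDl compDr E -compDr -tensmDl subrr.
by rewrite tensm0l compm0.
Qed.

Lemma left_dual_unique X Y Y' (e : hom (Y \oX X) unit_ob)
    (c : hom unit_ob (X \oX Y)) (e' : hom (Y' \oX X) unit_ob)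
    (c' : hom unit_ob (X \oX Y')) :
  is_left_dual e c -> is_left_dual e' c' -> isomorphic Y Y'.
Proof.
move=> H H'; have [u eu] := dual_ev_surj e H'; have [v ev] := dual_ev_surj e' H.
exists u, v; split.
  by apply: (dual_ev_inj2 H); rewrite tensm_compl compA ev eu tensm1 compm1.
by apply: (dual_ev_inj2 H'); rewrite tensm_compl compA eu ev tensm1 compm1.
Qed.

Lemma left_dual_iso X Y Y' (e : hom (Y \oX X) unit_ob)
    (c : hom unit_ob (X \oX Y)) (h : hom Y' Y) (h' : hom Y Y') :
  h' \oc h = idm _ -> h \oc h' = idm _ -> is_left_dual e c ->
  is_left_dual (e \oc (h \ot idm X)) ((idm X \ot h') \oc c).
Proof.
move=> h'h hh' [H1 H2]; split.
  rewrite -H1 !tensm_compl tensm_compr -!compA.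
  rewrite -(comp_eql _ (asc_nat (idm X) h (idm X))) -2!tensm_compl.
  by rewrite (compA (idm X \ot h)) -tensm_compr hh' tensm1 comp1m.
rewrite !tensm_compl tensm_compr -!compA.
rewrite (comp_eql _ (ascV_nat (idm Y') (idm X) h')) tensm1.
rewrite (comp_eql _ (tensm_swap (h \ot idm X) h')).
rewrite (comp_eql _ (tensm_swap e h')) (comp_eql _ (lun_nat h')).
rewrite -(comp_eql _ (ascV_nat h (idm X) (idm Y))) tensm1 tensm_swap.
rewrite (compA (ascV _ _ _)) (compA (e \ot _)) (compA (lun Y)) !compA.
rewrite -(compA h') -(compA h') -(compA h') H2 -compA run_nat compA h'h comp1m.
by [].
Qed.

End Duals.

Lemma right_dual_unique (k : fieldType) (C : monAbCat k) (X X' Y : C)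
    (e : hom (Y \oX X) unit_ob)
    (c : hom unit_ob (X \oX Y)) (e' : hom (Y \oX X') unit_ob)
    (c' : hom unit_ob (X' \oX Y)) :
  is_left_dual e c -> is_left_dual e' c' -> isomorphic X X'.
Proof.
move=> /rev_left_dual H /rev_left_dual H'.
exact: (left_dual_unique (C := rev_mon C) H H').
Qed.

Section DualExact.
Context (k : fieldType) (C : tensorCat k).
Implicit Types A B D T X Y : C.

Lemma ldualm_compE A B D (g : hom B D) (f : hom A B) :
  ldualm (g \oc f) = ldualm f \oc ldualm g.
Proof.
apply: (dual_ev_inj2 (ldualP A)); rewrite ldualmE tensm_compl compA ldualmE.
by rewrite -compA -tensm_swap compA ldualmE -compA -tensm_compr.
Qed.

Lemma ldualm1 A : ldualm (idm A) = idm _.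
Proof.
by apply: (dual_ev_inj2 (ldualP A)); rewrite ldualmE !tensm1.
Qed.

Lemma ldual_isomorphic A B : isomorphic A B -> isomorphic (ldual A) (ldual B).
Proof.
move=> [f [g [gf fg]]]; exists (ldualm g), (ldualm f).
by rewrite -!ldualm_compE gf fg !ldualm1.
Qed.

Lemma tensl_cokernel Y A B Q (f : hom A B) (c : hom B Q) :
  is_cokernel f c -> is_cokernel (idm Y \ot f) (idm Y \ot c).
Proof.
move=> fc; apply: cokernelI.
- exact/tensl_epi/cokernel_epi/fc.
- by rewrite -tensm_compr fc.1 tensm0r.
- move=> T w w0; have [|v ev] := cokernel_desc (g := trr (rcol Y) w) fc.
    by rewrite -trr_compr w0 trr0.
  by exists (trl (revl Y) v); rewrite -trl_compr ev (trrK (rdualP Y)).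
Qed.

Lemma ldualm_cokernel A B Q (f : hom A B) (c : hom B Q) T (x : hom T (ldual B)) :
  is_cokernel f c -> ldualm f \oc x = 0 -> exists x', ldualm c \oc x' = x.
Proof.
move=> fc fx0; have [|w ew] := cokernel_desc (g := ev B \oc (x \ot idm B)) (tensl_cokernel T fc).
  by rewrite -compA tensm_swap compA -ldualmE -compA -tensm_compl fx0 tensm0l compm0.
have [x' ex'] := dual_ev_surj w (ldualP Q); exists x'.
apply: (dual_ev_inj2 (ldualP B)); rewrite tensm_compl compA ldualmE.
by rewrite -compA -tensm_swap compA ex'.
Qed.

Lemma trl_ldualm X X' A B (j : hom X X') (psi : hom A (X \oX B)) :
  trl (ev X') (j \ot idm B \oc psi) = trl (ev X) psi \oc (ldualm j \ot idm A).
Proof.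
rewrite /trl -!compA tensm_compr.
rewrite (comp_eql _ (ascV_nat (idm (ldual X')) j (idm B))).
rewrite (compA (ev X' \ot _)) -tensm_compl -ldualmE tensm_compl -!compA.
by rewrite -(comp_eql _ (ascV_nat (ldualm j) (idm X) (idm B))) tensm1 tensm_swap.
Qed.

(** Maps from the dual of A to T correspond to maps from the unit to A (x) T. Precomposing with
    [ldualm j] becomes composing with j (x) T, which is mono. *)
Lemma ldualm_epi A B (j : hom A B) : is_mono j -> is_epi (ldualm j).
Proof.
move=> jm; apply/epiP => T y yj0.
apply: (proj1 (epiP _) (iso_epi (f := run (ldual A)) _)).
  by exists (runV _); rewrite runK runVK.
apply: (trr_eq0 (ldualP A)).
have /monoP := kernel_mono (tensr_kernel T (mono_kernel jm)); apply.
apply: (trl_eq0 (ldualP B)); rewrite trl_ldualm (trrK (ldualP A)).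
by rewrite -compA run_nat compA yj0 comp0m.
Qed.

(** By exactness g is [cokm f] followed by a mono j. The dual of [cokm f] has the kernel of the dual
    of f as its image, and the dual of j is epi. *)
Lemma exact_ldualm A B D (f : hom A B) (g : hom B D) :
  g \oc f = 0 -> exact f g -> exact (ldualm g) (ldualm f).
Proof.
move=> gf0 fg T x fx0; have [j jm <-] := exact_coker_mono gf0 fg.
have [x' <-] := ldualm_cokernel (cokP f) fx0.
have [T' [p [y [pe e]]]] := epi_lift x' (ldualm_epi jm).
by exists T', p, y; split=> //; rewrite ldualm_compE -[LHS]compA e compA.
Qed.

Lemma acyclic_dual (K : cpx C) : acyclic K -> acyclic (dual_cpx K).
Proof.
move=> K0 i; apply: exact_ldualm; first exact: cdd.
by apply: exact_atE (K0 (- i)) => //; rewrite ?opprB ?opprD // addrC.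
Qed.

End DualExact.

(** * Continuant complexes *)

Section ConeExact.
Context (k : fieldType) (C : abCat k).
Implicit Types (K L : cpx C).

Lemma idx_idx K (i j : int) : i = j -> idx K j i \oc idx K i j = idm (K i).
Proof. by move=> <-; rewrite idx_refl comp1m. Qed.

Definition homology_surj K L (f : chmap K L) j :=
  forall (T : C) (y : hom T (L j)), cd L j (j - 1) \oc y = 0 ->
    exists (T' : C) (p : hom T' T) (a : hom T' (K j)) (b : hom T' (L (j + 1))),
      [/\ is_epi p, cd K j (j - 1) \oc a = 0 &
          f j \oc a + cd L (j + 1) j \oc b = y \oc p].

Lemma bip_hom_eq (A B T : C) (u v : hom T (bip A B)) :
  pr1 A B \oc u = pr1 A B \oc v -> pr2 A B \oc u = pr2 A B \oc v -> u = v.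
Proof.
move=> e1 e2; rewrite -(comp1m u) -(comp1m v) -bip_id !compDl -!compA e1.
by rewrite e2.
Qed.

Lemma pr1_pair (A B T : C) (u : hom T A) (v : hom T B) :
  pr1 A B \oc (in1 A B \oc u + in2 A B \oc v) = u.
Proof. by rewrite compDr !compA pr1in1 pr1in2 comp1m comp0m addr0. Qed.

Lemma pr2_pair (A B T : C) (u : hom T A) (v : hom T B) :
  pr2 A B \oc (in1 A B \oc u + in2 A B \oc v) = v.
Proof. by rewrite compDr !compA pr2in1 pr2in2 comp1m comp0m add0r. Qed.

(** The piece of the long exact sequence saying that H_j of the cone vanishes if H_(j-1)(K) = 0 and
    H_j(K) maps onto H_j(L). *)
Lemma cone_exact K L (f : chmap K L) j :
  exact_at K (j - 1) -> homology_surj f j -> exact_at (cone f) j.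
Proof.
move=> Kj fj T z dz0.
have [x xE] : exists x, x = pr1 _ _ \oc z by eexists.
have [y yE] : exists y, y = pr2 _ _ \oc z by eexists.
have dx0 : cd K (j - 1) (j - 1 - 1) \oc x = 0.
  have := congr1 (fun u => pr1 _ _ \oc u) dz0.
  rewrite /= compA pr1_cone compm0 -compA -xE compNl => /eqP.
  by rewrite oppr_eq0 => /eqP.
have dy0 : f (j - 1) \oc x + cd L j (j - 1) \oc y = 0.
  have := congr1 (fun u => pr2 _ _ \oc u) dz0.
  by rewrite /= compA pr2_cone compm0 compDl -!compA -xE -yE idx_refl comp1m.
have Kj' : exact (cd K j (j - 1)) (cd K (j - 1) (j - 1 - 1)).
  by apply: exact_atE Kj; rewrite ?subrK.
have [T1 [p [x' [pe ex]]]] := Kj' _ _ dx0.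
(* Since (x, y) is a cycle of the cone and x = d x', the element y + f x' is a cycle of L;
   surjectivity writes it as f a + d b. The preimage of (x, y) is then (a - x', b). *)
have [|T2 [q [a [b [qe da0 eab]]]]] := fj _ (y \oc p + f j \oc x').
  rewrite compDr !compA -chf_comm -(compA (f (j - 1))) ex compA -compDl.
  by rewrite (addrC (_ \oc y)) dy0 comp0m.
have ej : j = j + 1 - 1 by rewrite addrK.
exists T2, (p \oc q), (in1 _ _ \oc (idx K j (j + 1 - 1) \oc (a - x' \oc q)) +
  in2 _ _ \oc b); split; first exact: epi_comp.
apply: bip_hom_eq.
  have D1 : pr1 _ _ \oc cd (cone f) (j + 1) j =
    - cd K (j + 1 - 1) (j - 1) \oc pr1 _ _ := pr1_cone f (j + 1) j.
  rewrite (comp_eql _ D1) pr1_pair compNl.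
  rewrite compA -(idx_cd K ej (erefl (j - 1))) idx_refl comp1m.
  by rewrite compDr da0 compNr sub0r opprK compA ex xE !compA.
have D2 : pr2 _ _ \oc cd (cone f) (j + 1) j = (idx L (j + 1 - 1) j \oc f _) \oc pr1 _ _ +
    cd L (j + 1) j \oc pr2 _ _ := pr2_cone f (j + 1) j.
rewrite (comp_eql1 _ D2) compDl -!compA pr1_pair pr2_pair.
rewrite (comp_eql _ (chf_idx f j (j + 1 - 1))) (compKV _ (idx_idx _ ej)).
by rewrite compDr compNr addrAC eab compDl -!compA addrK yE !compA.
Qed.

Lemma shift_exact K i j : j = i + 1 -> exact_at K j -> exact_at (cshift (-1) K) i.
Proof.
move=> ej Kj T x; rewrite /= /shift_cd expr1 scaleN1r compNl => /eqP.
rewrite oppr_eq0 => /eqP dx0.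
have Ki : exact (cd K (i + 1 - -1) (i - -1)) (cd K (i - -1) (i - 1 - -1)).
  by apply: exact_atE Kj; rewrite opprK // addrAC.
have [T' [p [y [pe e]]]] := Ki _ _ dx0.
exists T', p, (- y); split=> //.
by rewrite scaleN1r compNl compNr (opprK (_ \oc y)).
Qed.

End ConeExact.

Section Continuants.
Context (k : fieldType) (C : tensorCat k).
Implicit Types (A B D P Q X Y T : C) (K L : cpx C).

Definition nonpositive K := forall i, 0 < i -> is_zero (K i).

(** The homology is concentrated in degree 0, where it is [cycles K 0] since no terms lie in
    positive degrees. *)
Definition resolution K := nonpositive K /\ forall i, i < 0 -> exact_at K i.

Lemma tens_cpx_exact Y K i : exact_at K i -> exact_at (tens_cpx Y K) i.
Proof. by apply: tensl_exact; exact: cdd. Qed.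

Lemma tens_zero Y A : is_zero A -> is_zero (Y \oX A).
Proof. by move=> /is_zeroP A0; apply/is_zeroP; rewrite -tensm1 A0 tensm0r. Qed.

Lemma bip_zero A B : is_zero A -> is_zero B -> is_zero (bip A B).
Proof.
move=> A0 B0; apply/is_zeroP; apply: bip_hom_eq; rewrite compm1 compm0.
  exact: (A0 _).2.
exact: (B0 _).2.
Qed.

Lemma conc_zero A i : i != 0 -> is_zero (conc A i).
Proof. by move=> /negbTE i0; rewrite /= /conc_ob i0; apply: zobP. Qed.

Lemma conc_resolution A : resolution (conc A).
Proof.
split=> [i i0|i i0]; first by apply: conc_zero; rewrite gt_eqF.
by apply: is_zero_exact; apply: conc_zero; rewrite lt_eqF.
Qed.

Lemma cone_shift_nonpositive Y K L (f : chmap (tens_cpx Y K) L) :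
  nonpositive K -> nonpositive L -> nonpositive (cshift (-1) (cone f)).
Proof.
move=> K0 L0 i i0; apply: bip_zero; last first.
  by apply: L0; rewrite opprK ltr_wpDr.
by apply: tens_zero; apply: K0; rewrite opprK addrK.
Qed.

Lemma resolution_acyclic K :
  resolution K -> acyclic K <-> is_zero (cycles K 0).
Proof.
move=> [K0 Ke]; split=> [Ka|Z0 i].
  apply/is_zeroP; apply: (kerm_mono (f := cd K 0 (0 - 1))).
  rewrite compm1 compm0.
  have [T [p [y [pe e]]]] := Ka 0 _ _ (kerP (cd K 0 (0 - 1))).1.
  apply: (proj1 (epiP _) pe); rewrite -e.
  by rewrite ((K0 (0 + 1) _ _).2 y) ?compm0.
have [i0|i0|->] := ltgtP i 0; first exact: Ke; first exact/is_zero_exact/K0.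
move=> T x dx0; have [u <-] := kernel_lift (kerP _) dx0.
exists T, (idm T), 0; split; first exact: epi_id.
by rewrite compm1 compm0 ((Z0 T).2 u) compm0.
Qed.

Lemma nonpositive_acyclic K : nonpositive K -> acyclic K -> is_zero (cycles K 0).
Proof. by move=> K0 Ka; apply/resolution_acyclic. Qed.

Lemma conc_cycles A : is_iso (kerm (cd (conc A) 0 (0 - 1)) : hom _ A).
Proof.
have [|u e] := kernel_lift (g := idm (conc A 0)) (kerP (cd (conc A) 0 (0 - 1))).
  by rewrite comp0m.
exists u; split=> //.
by apply: (kerm_mono (f := cd (conc A) 0 (0 - 1))); rewrite compA e comp1m compm1.
Qed.

(** The last equation says that the transpose of phi is the map induced by [st_map s] on degree-0
    cycles, which are the only homology of both complexes. *)
Definition modelled X n (s : cstage X n.+1) (phi : hom (cycles (st_cur s) 0)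
    (itdual X n \oX cycles (st_prev s) 0)) :=
  [/\ resolution (st_prev s), resolution (st_cur s), rigid phi &
    kerm (cd (st_prev s) 0 (0 - 1)) \oc trl (ev (itdual X n)) phi =
    st_map s 0 \oc (idm (itdual X n.+1) \ot kerm (cd (st_cur s) 0 (0 - 1)))].

Lemma modelled0 X : exists phi, @modelled X 0 (continuant X 0) phi.
Proof.
have [i [ki ik]] := conc_cycles (unit_ob : C).
have [xi [kxi xik]] := conc_cycles X.
exists ((idm X \ot i) \oc runV X \oc kerm (cd (conc X) 0 (0 - 1))).
split; [exact: conc_resolution|exact: conc_resolution| |].
  apply: rigid_unit; last by exists (kerm _), i.
  apply: mono_comp; last exact: kerm_mono.
  apply: mono_comp; apply: iso_mono; last by exists (run X); rewrite runK runVK.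
  exists (idm X \ot (kerm (cd (conc unit_ob) 0 (0 - 1)) : hom _ (unit_ob : C))).
  by rewrite -!tensm_compr ki ik !tensm1.
have tE : trl (ev X) (runV X) = ev X.
  rewrite /trl lun_run run_nat -run_tens -!compA (compKV _ (ascVK _ _ _)).
  by rewrite -tensm_compr runVK tensm1 compm1.
rewrite trl_compr trl_compl [trl _ (runV X)]tE compA; congr (_ \oc _).
by rewrite compA -[RHS]comp1m -ik.
Qed.

(** Rigidity makes the induced map f on degree-0 cycles epi. Hence F is onto on homology in degrees
    at most 0, the shifted cone is again a resolution, and its degree-0 cycles are the kernel of
    f. *)
Lemma modelled_step X n (s : cstage X n.+1) phi : @modelled X n s phi ->
  ~ is_zero (cycles (st_prev s) 0) -> ~ is_zero (cycles (st_cur s) 0) ->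
  exists phi', @modelled X n.+1 (cnext s) phi' /\
    exists e : hom _ (cycles (st_prev s) 0), short_exact phi' e.
Proof.
case: s phi => L K F /= phi [/= [L0 Le] [K0 Ke] R sq] P0 Q0.
set f := trl _ phi in sq; set Y := itdual X n.+1 in F sq *.
set kK := kerm (cd K 0 (0 - 1)) in sq *; set kL := kerm (cd L 0 (0 - 1)) in sq *.
have fe : is_epi f := rigid_epi R P0 Q0.
have kYK : is_kernel (idm Y \ot cd K 0 (0 - 1)) (idm Y \ot kK).
  exact/tensl_kernel/kerP.
set E := cshift (-1) (cone F).
(* In degree 0 cycles lift through the epi f; in negative degrees L is exact, so every cycle is a
   boundary. *)
have F0 (j : int) : j <= 0 -> homology_surj F j.
  rewrite le_eqVlt => /orP [/eqP -> T y dy0|j0 T y dy0]; last first.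
    have [T' [p [b [pe e]]]] := Le j j0 _ _ dy0.
    by exists T', p, 0, b; rewrite !compm0 add0r.
  have [y' ey'] := kernel_lift (kerP _) dy0.
  have [T' [p [a [pe e]]]] := epi_lift y' fe.
  exists T', p, ((idm Y \ot kK) \oc a), 0; split=> //.
    by rewrite compA kYK.1 comp0m.
  by rewrite compm0 addr0 compA -sq -compA e compA ey'.
have Eres : resolution E.
  split; first exact: cone_shift_nonpositive.
  move=> i i0; have i1 : i + 1 <= 0 by rewrite -ltzD1 ltrD2r.
  apply: (@shift_exact _ _ _ _ (i + 1)) => //; apply: cone_exact; last exact: F0.
  by apply: tens_cpx_exact; apply: Ke; rewrite addrK.
set kE := kerm (cd E 0 (0 - 1)).
have dE : cd E 0 (0 - 1) = - cone_cd F (0 - -1) (0 - 1 - -1).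
  by rewrite /= /shift_cd expr1 scaleN1r.
have cE0 T (t : hom T (E 0)) : cd E 0 (0 - 1) \oc t = 0 <->
    cone_cd F (0 - -1) (0 - 1 - -1) \oc t = 0.
  by rewrite dE compNl; split=> [/eqP|->]; rewrite ?oppr0 // oppr_eq0 => /eqP.
have kE0 : cone_cd F (0 - -1) (0 - 1 - -1) \oc kE = 0 by apply/cE0; exact: (kerP _).1.
(* Here [0 - -1] is degree 1, where L vanishes: the degree-0 term of E has only its summand from Y
   (x) K. *)
have L1 : is_zero (L (0 - -1)) by apply: L0.
(* The degree of that summand as produced by shift and cone. It equals 0, and [idx] carries one
   expression to the other. *)
set m : int := 0 - -1 - 1.
have m0 : m = 0 by [].
have F_idx : F 0 \oc idx (tens_cpx Y K) m 0 = idx L m (0 - 1 - -1) \oc F m.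
  exact: chf_idx.
have dv0 : (idm Y \ot cd K 0 (0 - 1)) \oc (cofib F 0 \oc kE) = 0.
  have c := chf_comm (cofib F) 0 (0 - 1).
  by rewrite compA -[X in X \oc _]c -compA (kerP _).1 compm0.
have [phi' ephi'] := kernel_lift kYK dv0.
have f0 : f \oc phi' = 0.
  apply: (kerm_mono (f := cd L 0 (0 - 1))); rewrite -/kL compm0 compA sq.
  rewrite -compA ephi' /cofib_map /= compA compA F_idx.
  have := congr1 (fun u => pr2 _ _ \oc u) kE0.
  rewrite compm0 compA pr2_cone compDl -!compA.
  by rewrite ((L1 _).2 (pr2 _ _ \oc kE)) compm0 addr0.
have im0 : idx (tens_cpx Y K) 0 m \oc idx (tens_cpx Y K) m 0 = idm _ by exact: idx_idx.
have i0m : idx (tens_cpx Y K) m 0 \oc idx (tens_cpx Y K) 0 m = idm _ by exact: idx_idx.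
have kphi' : is_kernel f phi'.
  apply: kernelI => //.
    apply/monoP => T u u0; apply: (kerm_mono (f := cd E 0 (0 - 1))).
    rewrite compm0 -/kE; apply: bip_hom_eq; last first.
      by rewrite ((L1 _).2 (pr2 _ _ \oc (kE \oc u))) compm0.
    have : cofib F 0 \oc kE \oc u = 0 by rewrite -ephi' -compA u0 compm0.
    rewrite /cofib_map /= -!compA => /(congr1 (fun z => idx (tens_cpx Y K) 0 m \oc z)).
    by rewrite (compKV _ im0) !compm0.
  (* Completing x by 0 in L gives a cycle w of E, because f kills t; its lift to the cycles of E is
     the required factorization. *)
  move=> T t ft0; pose x := (idm Y \ot kK) \oc t.
  pose w : hom T (E 0) := in1 _ _ \oc (idx (tens_cpx Y K) 0 m \oc x) + in2 _ _ \oc 0.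
  have dw0 : cd E 0 (0 - 1) \oc w = 0.
    apply/cE0; apply: bip_hom_eq; rewrite compm0.
      rewrite compA pr1_cone -compA pr1_pair compNl compA.
      have -> : cd (tens_cpx Y K) (0 - -1 - 1) (0 - 1 - -1 - 1) \oc idx (tens_cpx Y K) 0 m
          = idx _ (0 - 1) _ \oc cd (tens_cpx Y K) 0 (0 - 1).
        by apply: esym; apply: idx_cd.
      by rewrite /x -compA (compA (cd _ _ _)) kYK.1 comp0m compm0 oppr0.
    rewrite compA pr2_cone compDl -!compA pr1_pair pr2_pair compm0 addr0.
    rewrite (comp_eql _ (chf_idx F 0 m)) /x (compA (F 0)) -sq -(compA kL) ft0.
    by rewrite !compm0.
  have [u eu] := kernel_lift (kerP _) dw0; exists u.
  apply: (kernel_mono kYK); rewrite compA ephi' -compA eu /cofib_map /= -compA.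
  by rewrite pr1_pair (compKV _ i0m).
exists phi'; split; last by exists f; exact: kernel_ses.
split=> //; first exact: rigid_step R fe kphi'.
(* In each degree [adj] is [trl], so the new square is the transpose of the equation defining
   phi'. *)
rewrite -[RHS]/(trl (ev Y) (cofib F 0) \oc (idm _ \ot kE)) -trl_compr.
by rewrite -ephi' trl_compl.
Qed.

(* If [H0E X j] is nonzero for all j < n, this is the only homology of E_n. *)
Definition H0E X n : C := cycles (Elow X n) 0.

Lemma st_prevE X n : st_prev (continuant X n) = Elow X n.
Proof. by case: n. Qed.

(** This holds without any nonvanishing assumption. The cone involves two consecutive complexes, so
    the induction carries both. *)
Lemma Elow_nonpositive X n : nonpositive (Elow X n).
Proof.
case: n => [|n]; first exact: (conc_resolution _).1.
suff [] : nonpositive (st_prev (continuant X n)) /\ nonpositive (Elow X n.+1) by [].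
elim: n => [|n [IH0 IH1]]; first by split; exact: (conc_resolution _).1.
by split=> //; exact: cone_shift_nonpositive.
Qed.

Lemma continuant_modelled X n : (forall j, (j <= n)%N -> ~ is_zero (H0E X j)) ->
  exists phi, @modelled X n (continuant X n) phi.
Proof.
elim: n => [_|n IH nz]; first exact: modelled0.
have [|phi mphi] := IH; first by move=> j /leqW; exact: nz.
have [||phi' [mphi' _]] := modelled_step mphi; last by exists phi'.
  by rewrite st_prevE; apply: (nz n).
exact: (nz n.+1).
Qed.

Lemma Elow_resolution X n : (forall j, (j < n)%N -> ~ is_zero (H0E X j)) ->
  resolution (Elow X n).
Proof.
case: n => [_|n nz]; first exact: conc_resolution.
by have [phi []] := continuant_modelled nz.
Qed.

(** The categorified continuant recursion: M_(n+2) is the kernel of the epi from X^(n+1) (x) M_(n+1)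
    to M_n. *)
Lemma H0E_ses X n : (forall j, (j <= n.+1)%N -> ~ is_zero (H0E X j)) ->
  exists (m : hom (H0E X n.+2) (itdual X n.+1 \oX H0E X n.+1)) (e : hom _ (H0E X n)),
    short_exact m e.
Proof.
move=> nz; have [|phi mphi] := @continuant_modelled X n.
  by move=> j /leqW; exact: nz.
have [||phi' [_]] := modelled_step mphi.
- by rewrite st_prevE; apply: (nz n).
- exact: (nz n.+1).
by rewrite st_prevE => -[e se]; exists phi', e.
Qed.

Lemma H0E0_iso X : isomorphic (H0E X 0) unit_ob.
Proof. exists (kerm _); exact: conc_cycles. Qed.

Lemma H0E1_iso X : isomorphic (H0E X 1) X.
Proof. exists (kerm _); exact: conc_cycles. Qed.

End Continuants.

(** * Lengths of alternating tensor products *)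

Section Words.
Context (k : fieldType) (C : tensorCat k).
Implicit Types A B D X Y Z V : C.

(* [alt A B n Z] is ... (x) A (x) B (x) A (x) Z with n alternating factors. *)
Fixpoint alt A B n Z : C := if n is m.+1 then alt B A m (A \oX Z) else Z.

Lemma alt_iso n A B A' B' Z Z' : isomorphic A A' -> isomorphic B B' ->
  isomorphic Z Z' -> isomorphic (alt A B n Z) (alt A' B' n Z').
Proof.
elim: n A B A' B' Z Z' => //= n IH A B A' B' Z Z' iA iB iZ.
by apply: IH => //; apply: tens_isomorphic.
Qed.

Lemma len_alt_ses n A B Z' Z Z'' (m : hom Z' Z) (e : hom Z Z'') :
  short_exact m e -> len (alt A B n Z) = (len (alt A B n Z') + len (alt A B n Z''))%N.
Proof.
elim: n A B Z' Z Z'' m e => [|n IH] A B Z' Z Z'' m e se /=.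
  exact: len_ses se.
exact: IH (tensl_ses A se).
Qed.

Lemma alt_tens n A B Z V : isomorphic (alt A B n (Z \oX V)) (alt A B n Z \oX V).
Proof.
elim: n A B Z => [|n IH] A B Z /=; first exact: isomorphic_refl.
apply: isomorphic_trans (IH _ _ _).
apply: alt_iso; try exact: isomorphic_refl.
exact/isomorphic_sym/asc_isomorphic.
Qed.

Lemma len_alt_ge n A B Z :
  (len (alt A B n unit_ob) * len Z <= len (alt A B n Z))%N.
Proof.
apply: leq_trans (len_tens _ _) _.
rewrite -(len_iso (alt_tens n A B unit_ob Z)) (len_iso (B := alt A B n Z)) //.
apply: alt_iso; try exact: isomorphic_refl; exact: lun_isomorphic.
Qed.

Lemma alt_zero n A B Z : is_zero Z -> is_zero (alt A B n Z).
Proof.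
elim: n A B Z => //= n IH A B Z Z0; apply: IH; exact: tens_zero.
Qed.

Lemma tpow_iso Y Y' n : isomorphic Y Y' -> isomorphic (tpow Y n) (tpow Y' n).
Proof.
move=> iY; elim: n => [|n IH] /=; first exact: isomorphic_refl.
exact: tens_isomorphic.
Qed.

Lemma tpowD Y i j : isomorphic (tpow Y i \oX tpow Y j) (tpow Y (i + j)).
Proof.
elim: j => [|j IH]; first by rewrite addn0; exact: run_isomorphic.
rewrite addnS /=; apply: isomorphic_trans (tens_isomorphic IH (isomorphic_refl Y)).
exact/isomorphic_sym/asc_isomorphic.
Qed.

Lemma len_tpowD Y i j : (len (tpow Y i) * len (tpow Y j) <= len (tpow Y (i + j)))%N.
Proof. by rewrite -(len_iso (tpowD Y i j)) len_tens. Qed.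

Lemma alt_tpow A B i Z : isomorphic (alt A B i.*2 Z) (tpow (B \oX A) i \oX Z).
Proof.
elim: i Z => [|i IH] Z; first exact/isomorphic_sym/lun_isomorphic.
rewrite doubleS /=; apply: isomorphic_trans (IH _) _.
apply: isomorphic_trans (isomorphic_sym (asc_isomorphic _ _ _)).
apply: tens_isomorphic (isomorphic_refl _) _.
exact/isomorphic_sym/asc_isomorphic.
Qed.

Section Walks.
Context (X X' : C).
Hypotheses (XX' : isomorphic (ldual X) X') (X'X : isomorphic (ldual X') X).

(** Under the two hypotheses the iterated duals of X alternate, up to isomorphism, between X and
    X'. *)
Definition letter j := if odd j then X' else X.

Lemma itdual_letter j : isomorphic (itdual X j) (letter j).
Proof.
elim: j => [|j IH]; first exact: isomorphic_refl.
apply: isomorphic_trans (ldual_isomorphic IH) _.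
by rewrite /letter /=; case: (odd j).
Qed.

Definition walk n j := len (alt (letter j) (letter j.+1) n (H0E X j)).

(** The end vertex 0 has the single neighbour 1, because M_0 is the unit and M_1 is X. *)
Lemma walk0S n : walk n.+1 0 = walk n 1.
Proof.
apply: len_iso; rewrite /=; apply: alt_iso; try exact: isomorphic_refl.
apply: isomorphic_trans (tens_isomorphic (isomorphic_refl _) (H0E0_iso X)) _.
apply: isomorphic_trans (run_isomorphic X) _.
exact/isomorphic_sym/H0E1_iso.
Qed.

(** The factor next to M_(j+1) is X^(j+1); [H0E_ses] splits this product into the two neighbours
    M_(j+2) and M_j, and tensoring is exact. *)
Lemma walkSS n j : (forall i, (i <= j.+1)%N -> ~ is_zero (H0E X i)) ->
  walk n.+1 j.+1 = (walk n j.+2 + walk n j)%N.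
Proof.
move=> nz; have [m [e se]] := H0E_ses nz.
have lS i : letter i.+2 = letter i by rewrite /letter /= negbK.
rewrite /walk [in LHS]/= (len_iso (B := alt (letter j.+2) (letter j.+1) n
    (itdual X j.+1 \oX H0E X j.+1))).
  by rewrite (len_alt_ses n _ _ se) (lS j.+1) (lS j).
apply: alt_iso; try exact: isomorphic_refl.
apply: tens_isomorphic (isomorphic_refl _).
exact/isomorphic_sym/itdual_letter.
Qed.

Lemma walk_zero n j : is_zero (H0E X j) -> walk n j = 0%N.
Proof. by move=> M0; apply/len_eq0/alt_zero. Qed.

Lemma walk_start j : ~ is_zero (H0E X j) -> (0 < walk 0 j)%N.
Proof. exact: len_gt0. Qed.

Lemma walk_unit n : walk n 0 = len (alt X X' n unit_ob).
Proof.
by apply: len_iso; apply: alt_iso; try exact: isomorphic_refl; exact: H0E0_iso.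
Qed.

Lemma walk_tpow i : walk i.*2 0 = len (tpow (ldual X \oX X) i).
Proof.
rewrite walk_unit; apply: len_iso; apply: isomorphic_trans (alt_tpow _ _ _ _) _.
apply: isomorphic_trans (run_isomorphic _) _; apply: tpow_iso.
exact: tens_isomorphic (isomorphic_sym XX') (isomorphic_refl _).
Qed.

End Walks.

(** The longer word is the shorter one tensored on the right with the nonzero object X, which cannot
    decrease the length. *)
Lemma walk_shift X X' n : ~ is_zero X -> (walk X' X n 0 <= walk X X' n.+1 0)%N.
Proof.
move=> X0; rewrite !walk_unit /=.
rewrite [leqRHS](len_iso (B := alt X' X n X)).
  apply: (leq_trans _ (len_alt_ge n X' X X)).
  by rewrite leq_pmulr // len_gt0.
apply: alt_iso; try exact: isomorphic_refl; exact: run_isomorphic.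
Qed.

End Words.

(** * Growth of supermultiplicative sequences *)

Section Growth.
Local Open Scope classical_set_scope.
Context (R : realType).
Implicit Types (x y c D r : R).

Lemma expr_unbounded r D : 1 < r -> exists n, D < r ^+ n.
Proof.
move=> r1; have bern n : 1 + n%:R * (r - 1) <= r ^+ n.
  elim: n => [|n IH]; first by rewrite mul0r addr0 expr0.
  rewrite exprS; apply: le_trans (_ : r * (1 + n%:R * (r - 1)) <= _); last first.
    by rewrite ler_wpM2l // ltW // (lt_trans ltr01).
  rewrite -subr_ge0.
  have -> : r * (1 + n%:R * (r - 1)) - (1 + n.+1%:R * (r - 1)) =
      n%:R * (r - 1) ^+ 2 by rewrite -natr1; ring.
  by rewrite mulr_ge0 // sqr_ge0.
have r0 : 0 < r - 1 by rewrite subr_gt0.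
exists (Num.bound `|D / (r - 1)|); apply: lt_le_trans (bern _).
have : D / (r - 1) < (Num.bound `|D / (r - 1)|)%:R.
  by apply: le_lt_trans (ler_norm _) _; apply: archi_boundP; apply: normr_ge0.
by rewrite ltr_pdivrMr // => /lt_le_trans; apply; rewrite lerDr.
Qed.

(** If y < x with y positive, the powers of x / y exceed D / c; for y = 0 the exponent 1
    suffices. *)
Lemma le_of_expr_bound x y c D : 0 < c -> 0 <= y ->
  (forall n, c * x ^+ n <= D * y ^+ n) -> x <= y.
Proof.
move=> c0 y0 H; rewrite leNgt; apply/negP => yx.
have [y00|yn0] := eqVneq y 0.
  have := H 1%N; rewrite y00 expr0n mulr0 expr1 leNgt.
  by rewrite mulr_gt0 // -y00.
have y1 : 0 < y by rewrite lt_neqAle eq_sym yn0.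
have [|n Dn] := @expr_unbounded (x / y) (D / c); first by rewrite ltr_pdivlMr ?mul1r.
have := H n; rewrite leNgt => /negP; apply.
move: Dn; rewrite expr_div_n ltr_pdivrMr // mulrAC ltr_pdivlMr ?exprn_gt0 //.
by rewrite (mulrC c).
Qed.

Variable a : nat -> nat.
Hypothesis aM : forall i j, (a i * a j <= a (i + j))%N.

Definition root_seq i : R := (a i)%:R `^ (i%:R^-1).

Lemma root_seq_ge0 i : 0 <= root_seq i.
Proof. exact: powR_ge0. Qed.

Lemma root_seq_expr i : (0 < i)%N -> root_seq i ^+ i = (a i)%:R.
Proof.
move=> i0; rewrite -powR_mulrn ?root_seq_ge0 // /root_seq -powRrM mulVf.
  by rewrite powRr1.
by rewrite pnatr_eq0 -lt0n.
Qed.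

Lemma le_root_seq i x : (0 < i)%N -> 0 <= x -> (x <= root_seq i) = (x ^+ i <= (a i)%:R).
Proof.
by move=> i0 x0; rewrite -root_seq_expr // ler_pXn2r // nnegrE root_seq_ge0.
Qed.

Lemma root_seq_le i x : (0 < i)%N -> 0 <= x -> (root_seq i <= x) = ((a i)%:R <= x ^+ i).
Proof.
by move=> i0 x0; rewrite -root_seq_expr // ler_pXn2r // nnegrE root_seq_ge0.
Qed.

Lemma supmul_expn k q : (0 < a 0)%N -> (a k ^ q <= a (q * k))%N.
Proof.
move=> a0; elim: q => [|q IH]; first by rewrite mul0n expn0.
by rewrite expnS mulSn; apply: leq_trans (aM _ _); rewrite leq_mul2l IH orbT.
Qed.

Definition root_sup := ereal_sup [set (root_seq i.+1)%:E | i in setT].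

Lemma root_seq_sup i : (0 < i)%N -> ((root_seq i)%:E <= root_sup)%E.
Proof. by case: i => // i _; apply: ereal_sup_ubound; exists i. Qed.

(** Fekete's argument: for n = q k + s one has a(n) >= a(k)^q, while x^n <= (x^k)^(q+1). The strict
    inequality x^k < a(k) absorbs the extra factor x^k once q >= q0. *)
Lemma root_seq_eventually k x : (forall i, 0 < a i)%N -> (0 < k)%N -> x < root_seq k ->
  \forall n \near \oo, x <= root_seq n.
Proof.
move=> apos k0 xk; have [x1|x1] := leP x 1.
  near=> n; apply: (le_trans x1); rewrite le_root_seq ?expr1n ?ler1n //.
  by near: n; exists 1%N.
have x0 : 0 <= x by rewrite ltW // (lt_trans ltr01).
have y0 : 0 < x ^+ k by rewrite exprn_gt0 // (lt_trans ltr01).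
have yb : x ^+ k < (a k)%:R by rewrite -root_seq_expr // ltr_pXn2r // nnegrE ?root_seq_ge0.
have [|q0 Hq0] := @expr_unbounded ((a k)%:R / x ^+ k) (x ^+ k).
  by rewrite ltr_pdivlMr ?mul1r.
near=> n; have n1 : (0 < n)%N by near: n; exists 1%N.
have nq : (q0 * k <= n)%N by near: n; exists (q0 * k)%N.
rewrite le_root_seq // (divn_eq n k); set q := (n %/ k)%N; set s := (n %% k)%N.
have q0q : (q0 <= q)%N by rewrite /q leq_divRL.
apply: (@le_trans _ _ ((a k)%:R ^+ q)); last first.
  rewrite -natrX ler_nat; apply: leq_trans (supmul_expn k q (apos 0%N)) _.
  by apply: leq_trans (aM _ _); rewrite leq_pmulr.
apply: (@le_trans _ _ ((x ^+ k) ^+ q.+1)).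
  rewrite -exprM (mulnC k) mulSn addnC; apply: ler_weXn2l; first exact: ltW.
  by rewrite leq_add2r ltnW // ltn_mod.
have yq0 : 0 < (x ^+ k) ^+ q by rewrite exprn_gt0.
rewrite exprS -ler_pdivlMr // -expr_div_n.
apply: le_trans (ltW Hq0) _; apply: ler_weXn2l q0q.
by rewrite ltW // ltr_pdivlMr ?mul1r.
Unshelve. all: by end_near.
Qed.

Hypothesis a_pos_or_zero : (forall i, 0 < a i)%N \/ (forall i, 0 < i -> a i = 0)%N.

Lemma root_seq_cvg : (fun i => (root_seq i)%:E) @ \oo --> root_sup.
Proof.
have [apos|a0] := a_pos_or_zero; last first.
  have r0 i : (0 < i)%N -> root_seq i = 0.
    move=> i0; apply/eqP; rewrite eq_le root_seq_ge0 andbT root_seq_le //.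
    by rewrite a0 // expr0n eqn0Ngt i0.
  have -> : root_sup = 0%E.
    apply/eqP; rewrite eq_le; apply/andP; split.
      by apply: ge_ereal_sup => _ [i _ <-]; rewrite r0.
    by have := @root_seq_sup 1%N isT; rewrite r0.
  apply: cvg_near_cst; near=> n; rewrite r0 //; near: n; exists 1%N => //.
have ev x : (x%:E < root_sup)%E -> \forall n \near \oo, x <= root_seq n.
  move=> /ereal_sup_gt [_ [k _ <-]]; rewrite lte_fin; exact: root_seq_eventually.
have sup0 : (0 <= root_sup)%E.
  by apply: le_trans (@root_seq_sup 1%N isT); rewrite lee_fin root_seq_ge0.
have sup_cases := sup0; case: root_sup sup_cases ev root_seq_sup => [s| |] // _ ev le_s.
  apply: cvg_EFin; first by near=> n.
  apply/cvgrPdist_le => e e0; near=> n.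
  rewrite ger0_norm ?subr_ge0 /=.
    by rewrite lerBlDr addrC -lerBlDr; near: n; apply: ev; rewrite lte_fin ltrBlDr ltrDl.
  by rewrite -lee_fin le_s //; near: n; exists 1%N.
apply/cvgeyPge => A; near=> n; rewrite lee_fin; near: n; apply: ev.
by rewrite ltry.
Unshelve. all: by end_near.
Qed.

Lemma limn_root_seq : limn (fun i => (root_seq i)%:E) = root_sup.
Proof. by apply/cvg_lim => //; apply: root_seq_cvg. Qed.

Lemma growth_lower x c : 0 < c -> (forall i, c * x ^+ i <= (a i)%:R) ->
  (x%:E <= root_sup)%E.
Proof.
move=> c0 H; rewrite leNgt; apply/negP.
have sup0 : (0 <= root_sup)%E.
  by apply: le_trans (@root_seq_sup 1%N isT); rewrite lee_fin root_seq_ge0.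
have sup_cases := sup0; case: root_sup sup_cases root_seq_sup => [s| |] //.
rewrite lee_fin lte_fin => s0 le_s; apply/negP; rewrite -leNgt.
(* The constant c + 1 serves exponent 0, where no bound by the supremum is available; in positive
   exponents a(i) <= s^i. *)
apply: (@le_of_expr_bound _ _ c (c + 1)) => // -[|n].
  by rewrite !expr0 !mulr1 lerDl.
apply: le_trans (H _) _; apply: (@le_trans _ _ (s ^+ n.+1)).
  by rewrite -root_seq_le // -lee_fin le_s.
by rewrite ler_peMl ?exprn_ge0 // lerDr ltW.
Qed.

(** For fixed i, a(i)^n <= a(n i) <= D x^(n i) for all n, so D disappears on taking n-th roots. *)
Lemma growth_upper x D : (0 < a 0)%N -> 0 <= x ->
  (forall i, (a i)%:R <= D * x ^+ i) -> (root_sup <= x%:E)%E.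
Proof.
move=> a0 x0 H; apply: ge_ereal_sup => _ [i _ <-]; rewrite lee_fin root_seq_le //.
apply: (@le_of_expr_bound _ _ 1 D) => //; first exact: exprn_ge0.
move=> n; rewrite mul1r -natrX -exprM mulnC.
by apply: le_trans (H _); rewrite ler_nat; apply: supmul_expn.
Qed.

End Growth.

(** * The eigenvector of the diagram A_(N-1) *)

Section Angles.
Context (R : realType).
Implicit Types (N j : nat).

Local Notation angle N := (pi / N%:R : R).

Definition mu N : R := 2 * cos (angle N).

(** The Perron-Frobenius eigenvector of the path with vertices 0, ..., N-2, with eigenvalue [mu N];
    the formula vanishes at the virtual neighbours -1 and N-1. *)
Definition eigv N j : R := sin (j.+1%:R * angle N).

Lemma eigv_rec N j : eigv N j.+2 + eigv N j = mu N * eigv N j.+1.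
Proof.
rewrite /eigv /mu; set t := angle N.
have -> : j.+3%:R * t = j.+2%:R * t + t by rewrite -(natr1 j.+2) mulrDl mul1r.
have -> : j.+1%:R * t = j.+2%:R * t - t by rewrite -(natr1 j.+1) mulrDl mul1r addrK.
by rewrite sinD sinB; ring.
Qed.

Lemma eigv_rec0 N : eigv N 1 = mu N * eigv N 0.
Proof.
rewrite /eigv /mu mul1r; set t := angle N.
have -> : 2%:R * t = t + t by rewrite mulr_natl mulr2n.
by rewrite sinD; ring.
Qed.

Lemma eigv_last N : eigv N.+1 N = 0.
Proof. by rewrite /eigv mulrCA divff ?pnatr_eq0 // mulr1 sinpi. Qed.

Lemma eigv_gt0 N j : (j.+1 < N)%N -> 0 < eigv N j.
Proof.
move=> jN; apply: sin_gt0_pi; have N0 : 0 < N%:R :> R by rewrite ltr0n (leq_trans _ jN).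
apply/andP; split; first by rewrite mulr_gt0 ?divr_gt0 ?pi_gt0.
by rewrite mulrCA gtr_pMr ?pi_gt0 // ltr_pdivrMr // mul1r ltr_nat.
Qed.

Lemma angle_itv N : (0 < N)%N -> angle N \in `[0, pi]%R.
Proof.
move=> N0; rewrite in_itv /= divr_ge0 ?pi_ge0 //=.
by rewrite ler_pdivrMr ?ltr0n // ler_peMr ?pi_ge0 // ler1n.
Qed.

Lemma mu_lt N N' : (0 < N)%N -> (N < N')%N -> mu N < mu N'.
Proof.
move=> N0 NN'; have N'0 := leq_trans N0 (ltnW NN').
rewrite /mu ltr_pM2l // ltr_cos ?angle_itv // ltr_pM2l ?pi_gt0 //.
by rewrite ltf_pV2 ?posrE ?ltr0n // ltr_nat.
Qed.

Lemma mu_inj N N' : (0 < N)%N -> (0 < N')%N -> mu N = mu N' -> N = N'.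
Proof.
move=> N0 N'0 e; have [NN'|N'N|//] := ltngtP N N'.
  by have := mu_lt N0 NN'; rewrite e ltxx.
by have := mu_lt N'0 N'N; rewrite e ltxx.
Qed.

Lemma mu_ge0 N : (1 < N)%N -> 0 <= mu N.
Proof.
move=> N1; rewrite mulr_ge0 // cos_ge0_pihalf //; apply/andP; split.
  by apply: (@le_trans _ _ 0); rewrite ?oppr_le0 divr_ge0 ?pi_ge0.
by rewrite ler_pM2l ?pi_gt0 // lef_pV2 ?posrE ?ltr0n ?(ltnW N1) // ler_nat.
Qed.

Lemma mu_lt2 N : (0 < N)%N -> mu N < 2.
Proof.
move=> N0; have -> : 2 = 2 * cos 0 :> R by rewrite cos0 mulr1.
rewrite ltr_pM2l // ltr_cos ?angle_itv //.
  by rewrite divr_gt0 ?pi_gt0 ?ltr0n.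
by rewrite in_itv /= lexx pi_ge0.
Qed.

Lemma mu_sup (x : R) : x < 2 -> exists2 N, (1 < N)%N & x < mu N.
Proof.
move=> x2; have e0 : 0 < 1 - x / 2 by rewrite subr_gt0 ltr_pdivrMr // mul1r.
have /cvgrPdist_lt /(_ _ e0) /nbhs_ballP [d /= d0 Hd] := @continuous_cos R 0.
(* The bound makes pi / N smaller than the radius d given by continuity of cosine at 0; the two
   successors ensure N > 1. *)
set N := (Num.bound (pi / d)).+2; exists N => //.
have N0 : 0 < N%:R :> R by rewrite ltr0n.
have aN : angle N < d.
  rewrite ltr_pdivrMr // mulrC -ltr_pdivrMr //.
  apply: (@lt_trans _ _ (Num.bound (pi / d))%:R); last by rewrite ltr_nat.
  by apply: archi_boundP; rewrite divr_ge0 ?pi_ge0 ?ltW.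
have := Hd (angle N); rewrite /ball /= sub0r normrN ger0_norm; last first.
  by rewrite divr_ge0 ?pi_ge0.
move=> /(_ aN); rewrite cos0 => /(le_lt_trans (ler_norm _)).
by rewrite ltrD2l ltrN2 ltr_pdivrMr // mulrC.
Qed.

End Angles.

(** * Two-sided bounds on walks by the eigenvector *)

Section WalkBounds.
Context (R : realType) (k : fieldType) (C : tensorCat k) (X X' : C).
Hypotheses (XX' : isomorphic (ldual X) X') (X'X : isomorphic (ldual X') X).
Variable N : nat.
Hypothesis nz : forall i, (i.+1 < N)%N -> ~ is_zero (H0E X i).

Lemma eigv_le1 j : eigv R N j <= 1.
Proof. exact: sin_le1. Qed.

Lemma walk_lower n j : (j.+1 < N)%N ->
  eigv R N j * mu R N ^+ n <= (walk X X' n j)%:R.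
Proof.
elim: n j => [|n IH] j jN.
  rewrite expr0 mulr1; apply: (le_trans (eigv_le1 j)).
  by rewrite ler1n; apply: walk_start; apply: nz.
(* At j = N-2 the neighbour N-1 is outside the induction, but its eigenvector entry is 0. *)
have IH' : eigv R N j.+1 * mu R N ^+ n <= (walk X X' n j.+1)%:R.
  have [jN'|] := ltnP j.+2 N; first exact: IH.
  rewrite leq_eqVlt ltnNge jN orbF => /eqP {1}->.
  by rewrite eigv_last mul0r.
case: j jN IH' => [|j] jN IH'.
  by rewrite walk0S exprS mulrCA mulrA -eigv_rec0.
rewrite walkSS //; last by move=> i ij; apply: nz; apply: leq_ltn_trans jN.
rewrite exprS mulrCA mulrA -eigv_rec mulrDl natrD lerD // IH //.
exact: ltnW.
Qed.

Hypothesis last_zero : is_zero (H0E X N.-1).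

Lemma walk_upper : exists2 D : R, 0 <= D &
  forall n j, (j.+1 < N)%N -> (walk X X' n j)%:R <= D * eigv R N j * mu R N ^+ n.
Proof.
(* The sum dominates every ratio of initial length to eigenvector entry, so the bound holds for n =
   0 at all vertices. *)
pose D : R := \sum_(j < N.-1) (walk X X' 0 j)%:R / eigv R N j.
have term_ge0 (i : 'I_N.-1) : 0 <= (walk X X' 0 i)%:R / eigv R N i.
  by rewrite divr_ge0 // ltW // eigv_gt0 // -ltn_predRL.
exists D; first by apply: sumr_ge0 => i _.
elim=> [|n IH] j jN.
  rewrite expr0 mulr1 -ler_pdivrMr ?eigv_gt0 //.
  have jN1 : (j < N.-1)%N by rewrite ltn_predRL.
  rewrite /D (bigD1 (Ordinal jN1)) //= lerDl; apply: sumr_ge0 => i _.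
  exact: term_ge0.
have IH' : (walk X X' n j.+1)%:R <= D * eigv R N j.+1 * mu R N ^+ n.
  have [jN'|] := ltnP j.+2 N; first exact: IH.
  rewrite leq_eqVlt ltnNge jN orbF => /eqP eN.
  by rewrite eN eigv_last mulr0 mul0r walk_zero //; move: last_zero; rewrite eN.
case: j jN IH' => [|j] jN IH'.
  by rewrite walk0S exprS mulrA -(mulrA D) (mulrC (eigv _ _ _)) -eigv_rec0.
rewrite walkSS //; last by move=> i ij; apply: nz; apply: leq_ltn_trans jN.
rewrite exprS mulrA -(mulrA D) (mulrC (eigv _ _ _)) -eigv_rec mulrDr mulrDl natrD.
by rewrite lerD // IH // ltnW.
Qed.

End WalkBounds.

(** * The first vanishing index and the value of the growth dimension *)

Section Dimension.
Context (R : realType) (k : fieldType) (C : tensorCat k).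
Implicit Types X Y : C.

Definition first_zero X N :=
  [/\ (1 < N)%N, forall i, (i.+1 < N)%N -> ~ is_zero (H0E X i) & is_zero (H0E X N.-1)].

Lemma H0E0_nonzero X : ~ is_zero (H0E X 0).
Proof. by move=> /(is_zero_iso (H0E0_iso X)); exact: unit_nonzero. Qed.

Lemma first_zeroP X n : is_zero (H0E X n) ->
  exists N, first_zero X N /\ (N <= n.+1)%N.
Proof.
move=> n0; pose P i := `[< is_zero (H0E X i) >].
have exP : exists i, P i by exists n; apply/asboolP.
have [m /asboolP m0 minm] := ex_minnP exP; exists m.+1; split; last first.
  by rewrite ltnS; apply: minm; apply/asboolP.
split=> //; first by case: m m0 {minm} => // /H0E0_nonzero.
move=> i; rewrite ltnS => im /asboolP /minm.
by rewrite leqNgt im.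
Qed.

(** Otherwise the words for X' grow at least like powers of [mu N.+1], while those for X grow at
    most like powers of [mu N]; the two kinds differ by a single letter. *)
Lemma first_zero_le X X' N : isomorphic (ldual X) X' -> isomorphic (ldual X') X ->
  first_zero X N -> exists N', first_zero X' N' /\ (N' <= N)%N.
Proof.
move=> XX' X'X [N1 nz last0].
have [[i iN]|nz'] := pselect (exists2 i, (i < N)%N & is_zero (H0E X' i)).
  by move=> /first_zeroP [N' [fz N'i]]; exists N'; split=> //; apply: leq_trans iN.
have [X0|X0] := pselect (is_zero X).
  case: nz'; exists 1%N => //; apply: (is_zero_iso (isomorphic_sym (H0E1_iso X'))).
  apply: (is_zero_iso XX'); apply/is_zeroP; rewrite -ldualm1.
  by rewrite (is_zeroP _).1 // ldualm0.
have [D D0 up] := walk_upper R XX' X'X nz last0.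
have low := @walk_lower R k C X' X X'X XX' N.+1.
have : mu R N.+1 <= mu R N.
  (* The extra factor [mu R N] pays for the additional letter in [walk_shift]. *)
  apply: (@le_of_expr_bound R _ _ (eigv R N.+1 0) (D * eigv R N 0 * mu R N)).
  - by apply: eigv_gt0; apply: ltnW.
  - exact: mu_ge0.
  - move=> n; rewrite -mulrA -exprS; apply: le_trans (up n.+1 0%N N1).
    have nzX' i : (i.+1 < N.+1)%N -> ~ is_zero (H0E X' i).
      by rewrite ltnS => iN i0; apply: nz'; exists i.
    apply: le_trans (low nzX' n 0%N (ltnW N1)) _.
    by rewrite ler_nat walk_shift.
by rewrite leNgt mu_lt // ltnW.
Qed.

Let a X i := len (tpow (ldual X \oX X) i).

Lemma len_tpow_pos_or_zero X :
  (forall i, 0 < a X i)%N \/ (forall i, 0 < i -> a X i = 0)%N.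
Proof.
have [Y0|Y0] := pselect (is_zero (ldual X \oX X)); [right=> -[|i] // _|left].
  by apply/len_eq0/tens_zero.
elim=> [|i IH]; first exact/len_gt0/unit_nonzero.
by apply: leq_trans (len_tens _ _); rewrite muln_gt0 IH len_gt0.
Qed.

Lemma bfDE X : bfD R X = sqrte (root_sup R (a X)).
Proof.
rewrite /bfD; congr sqrte; rewrite -limn_root_seq //; last first.
  exact: len_tpow_pos_or_zero.
exact: len_tpowD.
Qed.

Section Bounds.
Context (X X' : C).
Hypotheses (XX' : isomorphic (ldual X) X') (X'X : isomorphic (ldual X') X).

Lemma bfD_lower N : (1 < N)%N -> (forall i, (i.+1 < N)%N -> ~ is_zero (H0E X i)) ->
  ((mu R N)%:E <= bfD R X)%E.
Proof.
move=> N1 nz; rewrite bfDE.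
(* The i-th tensor power of X^* (x) X is a word of 2i letters, whence the square, undone by the root
   in [bfD]. *)
have H : ((mu R N ^+ 2)%:E <= root_sup R (a X))%E.
  apply: (growth_lower (c := eigv R N 0)).
  - exact: eigv_gt0.
  - move=> i; rewrite -exprM mulnC muln2 /a -(walk_tpow XX').
    exact: (walk_lower R XX' X'X nz).
have -> : (mu R N)%:E = sqrte ((mu R N ^+ 2)%:E).
  by rewrite EFin_expe sqrte_sqr gee0_abs // lee_fin mu_ge0.
rewrite lee_sqrt //; apply: le_trans H; rewrite lee_fin; exact: sqr_ge0.
Qed.

Lemma bfD_first_zero N : first_zero X N -> bfD R X = (mu R N)%:E.
Proof.
move=> [N1 nz last0]; apply/eqP; rewrite eq_le bfD_lower // andbT bfDE.
have [D D0 up] := walk_upper R XX' X'X nz last0.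
have -> : (mu R N)%:E = sqrte ((mu R N ^+ 2)%:E).
  by rewrite EFin_expe sqrte_sqr gee0_abs // lee_fin mu_ge0.
rewrite lee_sqrt ?lee_fin ?sqr_ge0 //.
apply: (@growth_upper _ _ _ _ (D * eigv R N 0)).
- exact: len_tpowD.
- exact/len_gt0/unit_nonzero.
- exact: sqr_ge0.
- by move=> i; rewrite -exprM mulnC muln2 /a -(walk_tpow XX'); apply: up.
Qed.

Lemma bfD_ge2 : (forall i, ~ is_zero (H0E X i)) -> (2%:E <= bfD R X)%E.
Proof.
move=> nz; rewrite leNgt; apply/negP.
have low N : (1 < N)%N -> ((mu R N)%:E <= bfD R X)%E by move=> N1; apply: bfD_lower.
have D0 : (0 <= bfD R X)%E by exact: sqrte_ge0.
case: (bfD R X) D0 low => // d _ low; rewrite lte_fin => /mu_sup [N N1].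
by rewrite ltNge -lee_fin low.
Qed.

End Bounds.
End Dimension.

(** * Boundedness in terms of vanishing degree-0 cycles *)

Section Boundedness.
Context (k : fieldType) (C : tensorCat k).
Implicit Types X : C.

Lemma bounded_zero X N : bounded X N -> is_zero (H0E X N.-1).
Proof.
by move=> [/derived_zeroP Xa _]; apply: nonpositive_acyclic (Elow_nonpositive X _) Xa.
Qed.

Lemma first_zero_acyclic X N : first_zero X N -> acyclic (Elow X N.-1).
Proof.
move=> [N1 nz last0]; apply/resolution_acyclic => //.
by apply: Elow_resolution => j jN; apply: nz; rewrite -ltn_predRL.
Qed.

Lemma first_zero_bounded X N : first_zero X N -> first_zero (rdual X) N -> bounded X N.
Proof.
move=> fz fz'; split; apply/derived_zeroP; first exact: first_zero_acyclic.
exact/acyclic_dual/first_zero_acyclic.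
Qed.

Lemma rdual_iso X : isomorphic (ldual (rdual X)) X.
Proof. exact: left_dual_unique (ldualP (rdual X)) (rdualP X). Qed.

(** Transporting along the isomorphism of X^** with X makes X a left dual of X^*; it is also a left
    dual of [rdual X], and right duals are unique. *)
Lemma ldual_rdual X : isomorphic (ldual (ldual X)) X ->
  isomorphic (ldual X) (rdual X).
Proof.
move=> [h [h' [h'h hh']]].
have H := left_dual_iso (h := h') (h' := h) hh' h'h (ldualP (ldual X)).
exact: right_dual_unique H (rdualP X).
Qed.

End Boundedness.

(** * Bounded objects *)

Section FirstZero.
Context (R : realType) (k : fieldType) (C : tensorCat k) (X : C).
Hypothesis hX : isomorphic (ldual (ldual X)) X.

Lemma first_zero_uniq (Y : C) N N' : first_zero Y N -> first_zero Y N' -> N = N'.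
Proof.
move=> [N1 nz z] [N'1 nz' z']; have [NN'|N'N|//] := ltngtP N N'.
  by case: (nz' N.-1) => //; rewrite prednK // ltnW.
by case: (nz N'.-1) => //; rewrite prednK // ltnW.
Qed.

(** Comparing X with its right dual and back gives N'' <= N' <= N, and N'' = N by uniqueness. *)
Lemma first_zero_rdual N : first_zero X N -> first_zero (rdual X) N.
Proof.
have XX' := ldual_rdual hX; have X'X := rdual_iso X => fz.
have [N' [fz' N'N]] := first_zero_le R XX' X'X fz.
have [N'' [fz'' N''N']] := first_zero_le R X'X XX' fz'.
suff -> : N = N' by [].
by apply/eqP; rewrite eqn_leq N'N andbT (first_zero_uniq fz fz'').
Qed.

Lemma bounded_first_zero N : (0 < N)%N -> bounded X N ->
  exists N', first_zero X N' /\ (N' <= N)%N.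
Proof. by move=> N0 /bounded_zero /first_zeroP; rewrite prednK. Qed.

Lemma first_zero_is_bounded N : first_zero X N -> bounded X N.
Proof. by move=> fz; apply: first_zero_bounded (first_zero_rdual fz). Qed.

Lemma strictly_boundedP N : (0 < N)%N -> strictly_bounded X N <-> first_zero X N.
Proof.
move=> N0; split=> [[bN minN]|fz].
  have [N' [fz]] := bounded_first_zero N0 bN.
  rewrite leq_eqVlt => /orP [/eqP <- //|N'N].
  case: (minN N'); last exact: first_zero_is_bounded.
  by rewrite N'N andbT; case: fz => /ltnW.
split; first exact: first_zero_is_bounded.
move=> N' /andP [N'0 N'N] /bounded_zero z; case: fz => _ /(_ N'.-1) nz _.
by case: nz => //; rewrite prednK.
Qed.

End FirstZero.

Unset Implicit Arguments.

Theorem theorem5p2p1 (R : realType) (k : closedFieldType) (C : tensorCat k)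
    (X : C) (hX : isomorphic (ldual (ldual X)) X) (N : nat) (hN : (0 < N)%N) :
  (strictly_bounded X N <-> bfD R X = (2 * cos (pi / N%:R))%:E) /\
  (unbounded X <-> (2%:E <= bfD R X)%E).
Proof.
have XX' := ldual_rdual hX; have X'X := rdual_iso X.
have DE N' : first_zero X N' -> bfD R X = (mu R N')%:E by exact: bfD_first_zero XX' X'X N'.
have noZ : ~ (exists N', first_zero X N') -> (2%:E <= bfD R X)%E.
  move=> H; apply: (bfD_ge2 R XX' X'X) => i /first_zeroP [N' [fz _]].
  by apply: H; exists N'.
split.
  apply: iff_trans (strictly_boundedP R hX hN) _; split=> [/DE //|DN].
  have {}DN : bfD R X = (mu R N)%:E := DN.
  have [[N' fz]|/noZ] := pselect (exists N', first_zero X N'); last first.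
    (* If no M_i vanishes then D(X) >= 2, contradicting [mu N < 2]. *)
    by rewrite DN lee_fin leNgt mu_lt2.
  suff -> : N = N' by [].
  have N'0 : (0 < N')%N by case: fz => /ltnW.
  (* Cosine is injective on [0, pi], which includes the angle for N = 1. *)
  by apply: (@mu_inj R) => //; apply/EFin_inj; rewrite -DN; apply: DE.
split=> [ub|D2 N' N'0 /(bounded_first_zero N'0) [N'' [fz _]]].
  apply: noZ => -[N' fz]; apply: (ub N'); last exact: (first_zero_is_bounded R hX fz).
  by case: fz => /ltnW.
move: D2; rewrite (DE _ fz) lee_fin leNgt mu_lt2 //.
by case: fz => /ltnW.
Qed.
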